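(* Let $\Omega\subset\mathbb{R}^2$ be a strictly convex bounded domain with $C^{2,\alpha}$ boundary $\partial\Omega$, $\alpha>1/2$, let $\mu>0$ be a known real number, and let $p>4$. Within the class of real valued symmetric 2-tensor fields $\mathbf{F}\in W^{3,p}(\Omega;\mathbb{R}^{2\times 2})$ that are supported in the interior of $\Omega$ and incompressible ($\delta\mathbf{F}=\mathbf{0}$ in $\Omega$), the tensor field $\mathbf{F}$ is uniquely determined in $\Omega$ by the data $u|_{\partial\Omega_+}$, where $u$ is the solution of the boundary value problem $$\boldsymbol\theta\cdot\nabla u(x,\boldsymbol\theta)+\mu u(x,\boldsymbol\theta)=\langle \mathbf{F}(x)\boldsymbol\theta,\boldsymbol\theta\rangle,\quad (x,\boldsymbol\theta)\in\Omega\times\mathbf{S}^1,\qquad u|_{\partial\Omega_-}=0.$$ That is, if $\mathbf{F}$ and $\tilde{\mathbf{F}}$ are two tensor fields in this class whose corresponding solutions $u$ and $\tilde u$ satisfy $u|_{\partial\Omega_+}=\tilde u|_{\partial\Omega_+}$, then $\mathbf{F}=\tilde{\mathbf{F}}$ in $\Omega$.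
   Context: $\mathbf{S}^1$ is the unit circle in $\mathbb{R}^2$, $\langle\cdot,\cdot\rangle$ is the Euclidean scalar product, and $\nabla$ is the gradient in the spatial variable $x$. A real symmetric 2-tensor field is a matrix-valued function $\mathbf{F}=\begin{pmatrix} f_{11}& f_{12}\\ f_{12}& f_{22}\end{pmatrix}$ with real valued entries. Its divergence is $$\delta\mathbf{F}=\big(\partial_{x_1}f_{11}+\partial_{x_2}f_{12},\ \partial_{x_1}f_{12}+\partial_{x_2}f_{22}\big),$$ and $\mathbf{F}$ is incompressible if $\delta\mathbf{F}=\mathbf{0}$. ''Supported in the interior of $\Omega$'' means that the support of $\mathbf{F}$ (as a field on $\mathbb{R}^2$) is contained in the open set $\Omega$. With $\eta(\zeta)$ the outer unit normal at $\zeta\in\partial\Omega$, set $\partial\Omega_\pm=\{(\zeta,\boldsymbol\theta)\in\partial\Omega\times\mathbf{S}^1:\ \pm\eta(\zeta)\cdot\boldsymbol\theta>0\}$. The boundary value problem has a unique solution $u$ in $\Omega\times\mathbf{S}^1$, and its trace on $\partial\Omega_+$ is the exponential X-ray transform $$u|_{\partial\Omega_+}(x,\boldsymbol\theta)=X_\mu\mathbf{F}(x,\boldsymbol\theta)=\int_{-\tau(x,\boldsymbol\theta)}^0\langle\mathbf{F}(x+t\boldsymbol\theta)\boldsymbol\theta,\boldsymbol\theta\rangle e^{\mu t}\,dt,$$ where $\tau(x,\boldsymbol\theta)$ is the length of the chord of $\Omega$ through $x$ in direction $\boldsymbol\theta$. *)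

(* Defs.v *)
From HB Require Import structures.
From mathcomp Require Import all_boot all_order all_algebra.
From mathcomp Require Import all_classical all_reals all_analysis.
Import Order.TTheory GRing.Theory Num.Theory.
Import numFieldNormedType.Exports.

Set Implicit Arguments.
Unset Strict Implicit.
Unset Printing Implicit Defensive.

Local Open Scope classical_set_scope.
Local Open Scope ring_scope.

Section plane.
Context {R : realType}.
Implicit Types (Omega U K : set (R * R)) (x y v w theta eta zeta : R * R).

(* The library norm of R * R is the sup norm: it only serves as a norm for the
   usual topology. Euclidean notions are expressed with dot. *)
Definition dot v w : R := v.1 * w.1 + v.2 * w.2.

Definition unit_circle : set (R * R) := [set theta | dot theta theta = 1].

Definition e1 : R * R := (1, 0).
Definition e2 : R * R := (0, 1).

Definition rot90 v : R * R := (- v.2, v.1).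

Definition partial1 (f : R * R -> R) : R * R -> R := fun x => 'D_e1 f x.
Definition partial2 (f : R * R -> R) : R * R -> R := fun x => 'D_e2 f x.

Definition grad (f : R * R -> R) x : R * R := (partial1 f x, partial2 f x).

Definition tapply (A : 'M[R]_2) v : R * R :=
  (A 0 0 * v.1 + A 0 1 * v.2, A 1 0 * v.1 + A 1 1 * v.2).

Definition lebesgue_measure2 := (@lebesgue_measure R \x @lebesgue_measure R)%E.

Local Notation plane := (measurableTypeR R * measurableTypeR R)%type.
Local Notation mu2 := lebesgue_measure2.

Definition domain Omega : Prop := [/\ open Omega, connected Omega & Omega !=set0].

Definition boundary Omega : set (R * R) := closure Omega `\` interior Omega.

Definition strictly_convex Omega : Prop :=
  forall x y (t : R), closure Omega x -> closure Omega y -> x <> y ->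
    0 < t -> t < 1 -> Omega (t *: x + (1 - t) *: y).

(* alpha is not required to be at most 1: for alpha > 1 the Hoelder bound forces
   the second derivative to be constant. *)
Definition C2_holder (alpha r : R) (g : R -> R) : Prop :=
  [/\ forall s, s \in `]- r, r[ -> derivable g s 1,
      forall s, s \in `]- r, r[ -> derivable (derive1 g) s 1 &
      exists C : R, forall s t, s \in `]- r, r[ -> t \in `]- r, r[ ->
        `|derive1n 2 g s - derive1n 2 g t| <= C * `|s - t| `^ alpha].

(* In the orthonormal frame (- rot90 e, e) centred at zeta, the box of
   half-sides r and h meets Omega in the part lying strictly under the graph
   of g. *)
Definition graph_chart Omega zeta (e : R * R) (r h : R) (g : R -> R) : Prop :=
  [/\ unit_circle e, 0 < r, 0 < h, g 0 = 0 &
      forall s t, s \in `]- r, r[ -> t \in `]- h, h[ ->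
        (Omega (zeta + s *: - rot90 e + t *: e) <-> t < g s)].

Definition C2_boundary (alpha : R) Omega : Prop :=
  forall zeta, boundary Omega zeta ->
    exists e r h g, graph_chart Omega zeta e r h g /\ C2_holder alpha r g.

(* The upward unit normal at 0 of the graph of g, in the frame of a chart. *)
Definition outer_unit_normal Omega zeta eta : Prop :=
  exists e r h g, [/\ graph_chart Omega zeta e r h g, derivable g 0 1 &
    eta = (Num.sqrt (1 + derive1 g 0 ^+ 2))^-1 *: (e - derive1 g 0 *: - rot90 e)].

Definition boundary_plus Omega : set ((R * R) * (R * R)) :=
  [set z | [/\ boundary Omega z.1, unit_circle z.2 &
    exists2 eta, outer_unit_normal Omega z.1 eta & 0 < dot eta z.2]].

Definition boundary_minus Omega : set ((R * R) * (R * R)) :=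
  [set z | [/\ boundary Omega z.1, unit_circle z.2 &
    exists2 eta, outer_unit_normal Omega z.1 eta & dot eta z.2 < 0]].

Fixpoint Ck (k : nat) (f : R * R -> R) : Prop :=
  if k is k'.+1 then
    [/\ forall x, differentiable f x, Ck k' (partial1 f) & Ck k' (partial2 f)]
  else continuous f.

Definition test_function Omega (phi : R * R -> R) : Prop :=
  [/\ forall k, Ck k phi, compact (closure [set x | phi x != 0]) &
      closure [set x | phi x != 0] `<=` Omega].

Definition loc_integrable Omega (f : R * R -> R) : Prop :=
  measurable_fun (Omega : set plane) f /\
  forall K, compact K -> K `<=` Omega -> mu2.-integrable K (EFin \o f).

(* g is the weak derivative d^(a+b) f / dx_1^a dx_2^b in Omega. *)
Definition weak_derivative Omega (a b : nat) (f g : R * R -> R) : Prop :=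
  [/\ loc_integrable Omega f, loc_integrable Omega g &
      forall phi, test_function Omega phi ->
        (\int[mu2]_(x in Omega) (f x * iter a partial1 (iter b partial2 phi) x)
         = (-1) ^+ (a + b) * \int[mu2]_(x in Omega) (g x * phi x))%R].

Definition Lp Omega (p : R) (f : R * R -> R) : Prop :=
  measurable_fun (Omega : set plane) f /\
  (\int[mu2]_(x in Omega) (`|f x| `^ p)%:E < +oo)%E.

Definition sobolev Omega (k : nat) (p : R) (f : R * R -> R) : Prop :=
  Lp Omega p f /\
  forall a b : nat, (a + b <= k)%N ->
    exists2 g, Lp Omega p g & weak_derivative Omega a b f g.

(* A tensor field on Omega is a function whose values outside Omega are
   irrelevant, and which matters only up to almost everywhere equality. *)

Definition ae_eq_on Omega (F G : R * R -> 'M[R]_2) : Prop :=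
  {ae mu2, forall x, Omega x -> F x = G x}.

Definition symmetric_field Omega (F : R * R -> 'M[R]_2) : Prop :=
  {ae mu2, forall x, Omega x -> (F x)^T = F x}.

Definition sobolev_field Omega (k : nat) (p : R) (F : R * R -> 'M[R]_2) : Prop :=
  forall i j, sobolev Omega k p (fun x => F x i j).

Definition ess_support (F : R * R -> 'M[R]_2) : set (R * R) :=
  [set x | forall U, open_nbhs x U -> ~ {ae mu2, forall y, U y -> F y = 0}].

(* The field is extended by 0 to the plane before its support is taken. *)
Definition supported_inside Omega (F : R * R -> 'M[R]_2) : Prop :=
  ess_support (patch (fun=> 0) Omega F) `<=` Omega.

Definition incompressible Omega (F : R * R -> 'M[R]_2) : Prop :=
  forall i, exists g1 g2,
    [/\ weak_derivative Omega 1 0 (fun x => F x i 0) g1,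
        weak_derivative Omega 0 1 (fun x => F x i 1) g2 &
        {ae mu2, forall x, Omega x -> g1 x + g2 x = 0}].

Definition admissible_field Omega (p : R) (F : R * R -> 'M[R]_2) : Prop :=
  [/\ symmetric_field Omega F, sobolev_field Omega 3 p F,
      supported_inside Omega F & incompressible Omega F].

(* The equation holds at every point, so its right-hand side is taken with the
   continuous representative G of F, which is unique since Omega is open and
   exists for F in W^{3,p} by Sobolev embedding. *)
Definition bvp_solution Omega (mu : R) (F : R * R -> 'M[R]_2)
    (u : R * R -> R * R -> R) : Prop :=
  exists G : R * R -> 'M[R]_2,
    [/\ {in Omega, continuous G}, ae_eq_on Omega F G,
        (forall theta, unit_circle theta ->
          {within closure Omega, continuous (u^~ theta)}),
        (forall x theta, Omega x -> unit_circle theta ->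
          differentiable (u^~ theta) x /\
          dot theta (grad (u^~ theta) x) + mu * u x theta =
            dot (tapply (G x) theta) theta) &
        (forall zeta theta, boundary_minus Omega (zeta, theta) ->
          u zeta theta = 0)].

End plane.

(* Main.v *)
Require Import Defs.
From mathcomp Require Import all_boot all_order all_algebra.
From mathcomp Require Import all_classical all_reals all_analysis.
From mathcomp Require Import measurable_realfun ring lra.
Import Order.TTheory GRing.Theory Num.Theory.
Import numFieldNormedType.Exports.
Set Implicit Arguments.
Unset Strict Implicit.
Unset Printing Implicit Defensive.
Local Open Scope classical_set_scope.
Local Open Scope ring_scope.

(** The difference of the two fields is a continuous symmetric tensor field H,
    supported in a compact subset of the domain, and w = u - u' solves
    theta . grad w + mu w = <H theta, theta> with zero trace on the whole
    boundary.  Everything is read off the two-sided Laplace transform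
    L(xi) = int H(x) exp(xi . x) dx at REAL frequencies xi.

    Transport.  Let theta be a unit vector with theta . xi = mu.  Then
    v = w exp(xi . x), extended by 0, satisfies
    theta . grad v = <H theta, theta> exp(xi . x) on the whole plane
    ([is_derive_zero_extension]): at a boundary point this is where the boundary
    conditions and the convexity of the domain enter, since a boundary point from
    which the direction theta leads into the domain belongs to the inflow or to the
    outflow boundary ([inner_direction]).  The integral of a directional derivative
    of a compactly supported function is zero, hence <L(xi) theta, theta> = 0
    ([exponential_ray_orthogonality]).

    Incompressibility.  Testing the vanishing weak divergence against exp(xi . x)
    times a smooth cutoff equal to 1 near the support gives L(xi) xi = 0
    ([divergence_free_moments]).

    Algebra.  If |xi| > mu, a unit vector theta with theta . xi = mu exists and is
    not parallel to xi; a symmetric matrix which kills xi and is isotropic on theta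
    is zero ([unit_vector_with_component], [symmetric_form_eq0]).  Hence L vanishes
    outside the disk of radius mu.

    Uniqueness.  The points (mu + 1 + m, n), with m and n natural numbers, lie
    outside that disk, so H(x) exp((mu + 1) x_1) is orthogonal to all monomials in
    exp(x_1) and exp(x_2), and therefore vanishes: powers of a quadratic polynomial
    in these two functions concentrate at any prescribed point
    ([exponential_moments_unique], [laplace_unique]). *)


(** * Lebesgue measure of the plane *)

Section measure.
Context {R : realType}.
Local Notation plane := (measurableTypeR R * measurableTypeR R)%type.
Local Notation mu2 := (@lebesgue_measure2 R).

Lemma prod_norm_le (x : R * R) (r : R) : (`|x| <= r) = (`|x.1| <= r) && (`|x.2| <= r).
Proof. by rewrite /Num.norm/= ge_max. Qed.
Lemma prod_norm_lt (x : R * R) (r : R) : (`|x| < r) = (`|x.1| < r) && (`|x.2| < r).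
Proof. by rewrite /Num.norm/= gt_max. Qed.

(** The measurable sets are those of the product of the two Borel sigma-algebras;
    squares with rational centres and radii 1/(n+1) form a countable basis of the
    topology, and each of them is a product. *)
Lemma open_measurable_plane (U : set (R * R)) : open U -> measurable (U : set plane).
Proof.
move=> oU.
pose B (q : rat * rat * nat) : set (R * R) :=
  ball (ratr q.1.1 : R) (q.2.+1%:R^-1) `*` ball (ratr q.1.2 : R) (q.2.+1%:R^-1).
have -> : U = \bigcup_(q in [set q | B q `<=` U]) B q.
  apply/seteqP; split => [x Ux|x [q qU]]; last exact: qU.
  have /nbhs_ballP [e /= e0 eU] : nbhs x U by exact: open_nbhs_nbhs.
  have e20 : 0 < e / 2 by rewrite divr_gt0.
  have [n _ /(_ _ (leqnn n))/= ne] := near_infty_natSinv_lt (PosNum e20).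
  have n0 : 0 < n.+1%:R^-1 :> R by rewrite invr_gt0.
  have appr (y : R) : exists q : rat, ball (ratr q : R) (n.+1%:R^-1) y.
    have yn : y < y + n.+1%:R^-1 by rewrite ltrDl.
    have [q] := rat_in_itvoo yn.
    rewrite in_itv/= => /andP[yq qn]; exists q.
    by rewrite /ball/= ger0_norm ?ltrBlDl// subr_ge0 ltW.
  have [q1 q1x] := appr x.1; have [q2 q2x] := appr x.2.
  exists (q1, q2, n) => //= y [/= By1 By2]; apply: eU.
  have tr (a b c : R) : ball c (n.+1%:R^-1) a -> ball c (n.+1%:R^-1) b -> ball a e b.
    rewrite /ball/= => h1 h2; have := ler_normD (a - c) (c - b).
    rewrite addrA subrK => /le_lt_trans; apply.
    by rewrite (splitr e) (distrC a) ltrD// (lt_trans _ ne).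
  by split => /=; [exact: (tr _ _ _ q1x By1)|exact: (tr _ _ _ q2x By2)].
rewrite bigcup_mkcond; apply: countable_bigcupT_measurable => // q.
case: ifP => _; last exact: measurable0.
by apply: measurableX; apply: open_measurable; exact: ball_open.
Qed.

Lemma closed_measurable_plane (U : set (R * R)) : closed U -> measurable (U : set
  plane).
Proof.
by move=> cU; rewrite -(setCK U); apply: measurableC; apply: open_measurable_plane;
  exact: closed_openC.
Qed.

Lemma continuous_measurable_plane (f : R * R -> R) : continuous f ->
  measurable_fun (setT : set plane) f.
Proof.
move=> /continuousP cf.
apply: (measurability _ (RGenOpens.measurableE R)).
move=> _ [_ [a [b ->] <-]]; rewrite setTI.
by apply: open_measurable_plane; apply: cf; exact: interval_open.
Qed.

Lemma lebesgue_measure_shift (a : R) (A : set (measurableTypeR R)) : measurable A ->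
  lebesgue_measure ((fun x : R => x + a) @^-1` A) = lebesgue_measure A.
Proof.
move=> mA; have mf : measurable_fun setT ((fun x => x + a) : measurableTypeR R ->
  measurableTypeR R) by exact: measurable_funD.
apply/esym.
apply: (@lebesgue_measure_unique _ (pushforward lebesgue_measure (fun x : R => x + a :
  measurableTypeR R))) => // _ [[b c]] _ <-.
transitivity (lebesgue_measure `]b - a, c - a]%classic); last first.
  congr lebesgue_measure; apply/seteqP.
  by split => x /=; rewrite !in_itv/= ltrBlDr lerBrDr.
rewrite !lebesgue_measure_itv/= !lte_fin ltrD2r.
by case: ifP => // _; rewrite -!EFinB; congr EFin; ring.
Qed.

Lemma measurable_shift (h : R * R) : measurable_fun setT ((fun x : R * R => x + h) :
  plane -> plane).
Proof.
apply: measurable_fun_pair => /=.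
apply: (@measurable_funD _ _ _ setT fst (cst h.1)) => //.
apply: (@measurable_funD _ _ _ setT snd (cst h.2)) => //.
Qed.

(** Both measures are products on rectangles, so the uniqueness of the product
    measure reduces the claim to translations of the line. *)
Lemma mu2_shift (h : R * R) (A : set plane) : measurable A ->
  mu2 ((fun x : R * R => x + h) @^-1` A) = mu2 A.
Proof.
move=> mA.
have mf := measurable_shift h.
apply/esym.
apply: (@product_measure_unique _ _ _ _ R lebesgue_measure lebesgue_measure
  (pushforward mu2 ((fun x : R * R => x + h) : plane -> plane))) => //.
move=> B C mB mC.
transitivity (mu2 (((fun x : R => x + h.1) @^-1` B) `*` ((fun x : R => x + h.2) @^-1`
  C))) => //.
rewrite /lebesgue_measure2 product_measure1E.
- by congr (_ * _)%E; exact: lebesgue_measure_shift.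
- by rewrite -[X in measurable X]setTI;
  apply: (@measurable_funD _ _ _ setT id (cst h.1)).
- by rewrite -[X in measurable X]setTI;
  apply: (@measurable_funD _ _ _ setT id (cst h.2)).
Qed.

Definition box (C : R) : set (R * R) := [set x | `|x| <= C].

Lemma measurable_box C : measurable (box C : set plane).
Proof.
apply: closed_measurable_plane.
apply: (@closed_comp _ _ (fun x : R * R => `|x|) [set r | r <= C]);
  last exact: closed_le.
by move=> x _; exact: norm_continuous.
Qed.

Lemma mu2_box_fin C : (mu2 (box C) < +oo)%E.
Proof.
apply: (@le_lt_trans _ _ (mu2 (`[-C, C]%classic `*` `[-C, C]%classic))).
  apply: le_measure; rewrite ?inE; [exact: measurable_box|exact: measurableX|].
  by move=> x; rewrite /box/= prod_norm_le !in_itv/= -!ler_norml => /andP.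
have itvfin : (lebesgue_measure (`[(- C)%R, C]%classic : set R) < +oo)%E.
  by rewrite lebesgue_measure_itv/=; case: ifP => // _; rewrite -EFinB ltry.
rewrite /lebesgue_measure2 product_measure1E//.
apply: lte_mul_pinfty; [exact: measure_ge0| |exact: itvfin].
by rewrite ge0_fin_numE; [exact: itvfin|exact: measure_ge0].
Qed.

(** The class of integrands used throughout: it is stable under the algebraic
    operations, under translations and under multiplication by continuous functions,
    and contains the zero extensions of functions continuous up to the boundary of a
    bounded domain, which jump at the boundary in general. *)
Definition bounded_bsupp (f : R * R -> R) := measurable_fun (setT : set plane) f /\
  exists C : R, forall x, `|f x| <= C /\ (f x != 0 -> `|x| <= C).

Lemma bounded_bsupp_integrable f : bounded_bsupp f -> mu2.-integrable setT (EFin \o f).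
Proof.
move=> [mf [C fC]].
have -> : EFin \o f = (EFin \o f) \_ (box C).
  apply/funext => x; rewrite patchE; case: ifPn => //=.
  rewrite notin_setE /box/= => xC; congr EFin; apply/eqP.
  by apply: contra_notT xC => /(proj2 (fC x)).
apply/(integrable_mkcond _ (measurable_box C)).
apply: measurable_bounded_integrable; [exact: measurable_box|exact: mu2_box_fin| |].
  exact: measurable_funTS.
exists C; split; first exact: num_real.
by move=> M CM x _ /=; rewrite (le_trans (proj1 (fC x)))// ltW.
Qed.

End measure.

(** * Integrals of bounded functions with bounded support *)

Section integral.
Context {R : realType}.
Local Notation plane := (measurableTypeR R * measurableTypeR R)%type.
Local Notation mu2 := (@lebesgue_measure2 R).
Implicit Types (f g v : R * R -> R).

Lemma bounded_bsuppD f g : bounded_bsupp f -> bounded_bsupp g ->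
  bounded_bsupp (fun x => f x + g x).
Proof.
move=> [mf [C fC]] [mg [D gD]]; split; first exact: measurable_funD.
have C0 : 0 <= C by rewrite (le_trans _ (proj1 (fC 0))).
have D0 : 0 <= D by rewrite (le_trans _ (proj1 (gD 0))).
exists (C + D) => x; have [f1 f2] := fC x; have [g1 g2] := gD x; split.
  by rewrite (le_trans (ler_normD _ _))// lerD.
have [->|/f2 xC _] := eqVneq (f x) 0; last by rewrite (le_trans xC)// lerDl.
by rewrite add0r => /g2 xD; rewrite (le_trans xD)// lerDr.
Qed.

Lemma bounded_bsuppM f g : bounded_bsupp f -> measurable_fun (setT : set plane) g ->
  (forall C, exists D, forall x, `|x| <= C -> `|g x| <= D) ->
  bounded_bsupp (fun x => f x * g x).
Proof.
move=> [mf [C fC]] mg gb; split; first exact: measurable_funM.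
have [D gD] := gb C.
have C0 : 0 <= C by rewrite (le_trans _ (proj1 (fC 0))).
exists (Num.max C (C * D)) => x; have [f1 f2] := fC x; split.
  rewrite normrM le_max; apply/orP; right.
  have [->|/f2 xC] := eqVneq (f x) 0; last by rewrite ler_pM// gD.
  have D0 : 0 <= D by rewrite (le_trans _ (gD 0 _)) ?normr0.
  by rewrite normr0 mul0r mulr_ge0.
by rewrite mulf_eq0 negb_or => /andP[/f2 xC _]; rewrite le_max xC.
Qed.

Lemma compact_box (C : R) : compact (box C).
Proof.
have -> : box C = `[- C, C]%classic `*` `[- C, C]%classic.
  apply/seteqP; split=> x; rewrite /box/= prod_norm_le !in_itv/= -!ler_norml.
    by move/andP.
  by move=> h; apply/andP.
by apply: compact_setX; exact: segment_compact.
Qed.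

Lemma continuous_bounded_on_box g : continuous g ->
  forall C, exists D, forall x, `|x| <= C -> `|g x| <= D.
Proof.
move=> cg C.
have : compact (g @` box C).
  by apply: continuous_compact; [exact: continuous_subspaceT|exact: compact_box].
move=> /compact_bounded[M [_ Mg]]; exists (M + 1) => x xC.
by apply: (Mg (M + 1)); [rewrite ltrDl|exists x].
Qed.

Lemma bounded_bsuppMc f g : bounded_bsupp f -> continuous g ->
  bounded_bsupp (fun x => f x * g x).
Proof.
move=> bf cg; apply: bounded_bsuppM => //; first exact: continuous_measurable_plane.
exact: continuous_bounded_on_box.
Qed.

Lemma bounded_bsuppZ (r : R) f : bounded_bsupp f -> bounded_bsupp (fun x => r * f x).
Proof.
move=> bf; under eq_fun do rewrite mulrC.
by apply: bounded_bsuppMc => // x; exact: cst_continuous.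
Qed.

Lemma bounded_bsupp_shift f h : bounded_bsupp f -> bounded_bsupp (fun x => f (x + h)).
Proof.
move=> [mf [C fC]]; split; first by apply: (measurableT_comp mf);
  exact: measurable_shift.
have C0 : 0 <= C by rewrite (le_trans _ (proj1 (fC 0))).
exists (C + `|h|) => x; have [f1 f2] := fC (x + h); split.
  by rewrite (le_trans f1)// lerDl.
move=> /f2 xh; rewrite -[x](addrK h) (le_trans (ler_normB _ _))//.
by rewrite lerD2r.
Qed.

Lemma Rintegral_shift f h : bounded_bsupp f ->
  \int[mu2]_x f (x + h) = \int[mu2]_x f x.
Proof.
move=> bf; have mf := measurable_shift h.
rewrite /Rintegral; congr fine.
rewrite -[RHS](@eq_measure_integral _ _ _ setT mu2 (pushforward mu2 ((fun x : R * R =>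
  x + h) : plane -> plane))).
  rewrite integral_pushforward//.
    by apply/measurable_EFinP; case: bf.
  by rewrite preimage_setT; apply: bounded_bsupp_integrable (bounded_bsupp_shift h bf).
by move=> A mA _; exact: mu2_shift.
Qed.

Lemma Rintegral_bsuppD f g : bounded_bsupp f -> bounded_bsupp g ->
  \int[mu2]_x (f x + g x) = \int[mu2]_x f x + \int[mu2]_x g x.
Proof. by move=> bf bg; rewrite RintegralD//; exact: bounded_bsupp_integrable. Qed.

Lemma Rintegral_bsuppZ (r : R) f : bounded_bsupp f ->
  \int[mu2]_x (r * f x) = r * \int[mu2]_x f x.
Proof. by move=> bf; rewrite RintegralZl//; exact: bounded_bsupp_integrable. Qed.

Lemma is_derive_along v (theta x : R * R) (t d : R) : is_derive (x + t *: theta) theta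
  v d ->
  is_derive t 1 (fun s => v (x + s *: theta)) d.
Proof.
move=> [dv vd].
have E : (fun h : R => h^-1 *: (((fun s => v (x + s *: theta)) \o shift t) (h *: 1) -
  v (x + t *: theta))) =
  (fun h => h^-1 *: ((v \o shift (x + t *: theta)) (h *: theta) - v (x + t *: theta))).
  apply/funext => h /=; congr (_ *: (v _ - _)).
  by rewrite [h *: 1]mulr1 scalerDl addrCA.
split; first by rewrite /derivable E.
by rewrite /derive E.
Qed.

(** The difference quotients of v integrate to 0 by translation invariance, and the
    mean value theorem bounds them by the supremum of the derivative on a fixed box, so
    that dominated convergence applies.  The transport equation gives the derivative
    in this direction only. *)
Lemma Rintegral_directional_derivative v g (theta : R * R) :
  bounded_bsupp v -> bounded_bsupp g -> (forall x, is_derive x theta v (g x)) ->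
  \int[mu2]_x g x = 0.
Proof.
move=> bv bg dv.
(* the difference quotients with increment 1/(n+1) *)
pose q (n : nat) x := n.+1%:R * (v (x + n.+1%:R^-1 *: theta) - v x).
have bq n : bounded_bsupp (q n).
  apply: bounded_bsuppZ.
  under eq_fun do rewrite -mulN1r.
  apply: bounded_bsuppD; first exact: bounded_bsupp_shift.
  exact: bounded_bsuppZ.
have q0 n : \int[mu2]_x q n x = 0.
  rewrite Rintegral_bsuppZ; last first.
    under eq_fun do rewrite -mulN1r.
    apply: bounded_bsuppD; first exact: bounded_bsupp_shift.
    exact: bounded_bsuppZ.
  rewrite RintegralB//; last 2 first.
    by apply: bounded_bsupp_integrable; exact: bounded_bsupp_shift.
    exact: bounded_bsupp_integrable.
  by rewrite Rintegral_shift// subrr mulr0.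
have [_ [C vC]] := bv; have [_ [D gD]] := bg.
have C0 : 0 <= C by rewrite (le_trans _ (proj1 (vC 0))).
have D0 : 0 <= D by rewrite (le_trans _ (proj1 (gD 0))).
(* increments have norm at most that of theta, whence the size of the box *)
pose G x := D * \1_(box (C + `|theta|)) x : R.
have vout y : C < `|y| -> v y = 0.
  by move=> yC; apply/eqP; apply: contraTT yC => /(proj2 (vC y)); rewrite leNgt.
have qG n x : `|q n x| <= G x.
  rewrite /G indicE; case: (boolP (x \in box _)); last first.
    rewrite notin_setE /box/= => /negP; rewrite -ltNge => xC.
    have -> : q n x = 0.
      rewrite /q (vout x) ?(vout (x + _)) ?subr0 ?mulr0//; last first.
        by rewrite (le_lt_trans _ xC)// lerDl.
      have nle : `|n.+1%:R^-1 *: theta| <= `|theta|.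
        by rewrite normrZ ger0_norm// ler_piMl// invf_le1// ler1n.
      have := ler_normB (x + n.+1%:R^-1 *: theta) (n.+1%:R^-1 *: theta).
      rewrite addrK; move: nle xC; lra.
    by rewrite normr0 mulr0.
  move=> _; rewrite mulr1.
  have n0 : 0 < n.+1%:R^-1 :> R by rewrite invr_gt0.
  have [||c _] := @MVT _ (fun s => v (x + s *: theta)) (fun s => g (x + s *: theta)) 0
    _ n0.
  - by move=> y _; exact: is_derive_along.
  - apply: derivable_within_continuous => y _.
    by have [] := @is_derive_along v theta x y _ (dv _).
  rewrite scale0r addr0 subr0 /q => ->.
  by rewrite mulrC -mulrA mulVf// mulr1; case: (gD (x + c *: theta)).
have iG : mu2.-integrable setT (EFin \o G).
  apply: bounded_bsupp_integrable; split.
    apply: measurable_funM; first exact: measurable_cst.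
    by apply: measurable_indic; exact: measurable_box.
  exists (D + C + `|theta|) => x; rewrite /G indicE; split; last first.
    by case: (boolP (x \in box _)); rewrite ?mulr0 ?eqxx// in_setE /box/= => xC _;
      move: xC; lra.
  by case: (_ \in _); rewrite ?mulr1 ?mulr0 ?normr0 ?ger0_norm//;
    have := normr_ge0 theta; lra.
have [||_ _] := @dominated_convergence _ _ _ mu2 setT measurableT
  (fun n => EFin \o q n) (EFin \o g) (EFin \o G)
  (fun n => measurable_int _ (bounded_bsupp_integrable (bq n)))
  (measurable_int _ (bounded_bsupp_integrable bg)) _ iG _.
- apply: aeW => x _; apply/fine_cvgP; split; first exact: nearW.
  have [dvx vdx] := dv x.
  have dvc : (fun h => h^-1 *: ((v \o shift x) (h *: theta) - v x)) @ 0^' --> g x.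
    by rewrite -vdx; exact: dvx.
  move/cvgr_dnbhsP : dvc => /(_ (fun n => n.+1%:R^-1)) dvc.
  apply: cvg_trans (dvc _); last first.
    split; first by move=> n; rewrite invr_eq0.
    apply/cvgrPdist_lt => e e0; near=> n; rewrite sub0r normrN ger0_norm//.
    near: n; exact: (near_infty_natSinv_lt (PosNum e0)).
  apply: near_eq_cvg; apply: nearW => n /=.
  by rewrite /q invrK (addrC x).
- by apply: aeW => x n _; rewrite /= lee_fin; exact: qG.
have -> : [sequence (\int[mu2]_x (EFin \o q n) x)%E]_n = fun=> 0%E.
  apply/funext => n; have := q0 n; rewrite /Rintegral => qn.
  rewrite -[LHS]fineK ?[in LHS]qn//.
  by apply: integrable_fin_num => //; exact: bounded_bsupp_integrable.
move=> H; have := @cvg_unique _ (@ereal_hausdorff R) _ _ _ _ (cvg_cst 0%E) H.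
by rewrite /Rintegral => <-.
Unshelve. all: end_near. Qed.
End integral.

(** * Concentration of powers at a point *)

Section peak.
Context {R : realType}.
Local Notation plane := (measurableTypeR R * measurableTypeR R)%type.
Local Notation mu2 := (@lebesgue_measure2 R).
Implicit Types (f g q : R * R -> R) (x a : R * R).

Lemma ball_plane x r : ball x r = ball x.1 r `*` ball x.2 r :> set (R * R).
Proof. by apply/seteqP; split. Qed.

Lemma mu2_ball x r : 0 <= r -> mu2 (ball x r) = ((r *+ 2) * (r *+ 2))%:E.
Proof.
move=> r0; have bE (y : R) : lebesgue_measure (ball y r) = (r *+ 2)%:E.
  exact: lebesgue_measure_ball.
rewrite ball_plane /lebesgue_measure2 product_measure1E; last 2 first.
- by apply: open_measurable; exact: ball_open.
- by apply: open_measurable; exact: ball_open.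
by rewrite EFinM; congr (_ * _)%E; exact: bE.
Qed.

(** A nonempty open set contains a ball, which has positive measure. *)
Lemma ae_eq_continuous (U : set (R * R)) (T : normedModType R) (f g : R * R -> T) :
  open U ->
  {in U, continuous f} -> {in U, continuous g} ->
  {ae mu2, forall x, U x -> f x = g x} -> forall x, U x -> f x = g x.
Proof.
move=> oU cf cg fg x Ux; apply/eqP; apply: contrapT => /negP fgx.
have h0 : 0 < `|f x - g x| by rewrite normr_gt0 subr_eq0.
have cfg : (fun y => f y - g y) @ x --> f x - g x.
  by apply: cvgB; [apply: cf|apply: cg]; rewrite inE.
move/cvgrPdist_lt : cfg => /(_ _ h0) cfg.
have : \forall y \near x, U y /\ f y != g y.
  near=> y; split; first by near: y; exact: open_nbhs_nbhs.
  have fgy : `|(f x - g x) - (f y - g y)| < `|f x - g x| by near: y; exact: cfg.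
  by apply: contraTN fgy => /eqP ->; rewrite subrr subr0 ltxx.
move=> /nbhs_ballP[r /= r0 rU].
have mB : measurable (ball x r : set plane).
  by apply: open_measurable_plane; exact: ball_open.
have : mu2 (ball x r) = 0%E.
  apply/(@negligibleP _ _ _ mu2 _ mB);
    apply: negligibleS fg => y /rU[Uy /eqP fgy] /= fgU.
  by apply: fgy; exact: fgU.
rewrite mu2_ball ?ltW// => /eqP.
by rewrite eqe mulf_eq0 orbb mulrn_eq0/= gt_eqF.
Unshelve. all: end_near. Qed.

(** If f a were positive, f q^N would be at least (f a / 2) b^N on a small ball around
    a and at least - C c^N elsewhere, with 0 < c < b < 1; for large N the first
    contribution to the integral wins. *)
Lemma Rintegral_peak f q a :
  continuous f -> bounded_bsupp f -> continuous q -> q a = 1 ->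
  (forall x, f x != 0 -> 0 <= q x) ->
  (forall x, x != a -> q x < 1) ->
  (forall N, \int[mu2]_x (f x * q x ^+ N) = 0) -> f a <= 0.
Proof.
move=> cf bf cq qa q0 q1 fq0; rewrite leNgt; apply/negP => fa.
have [mf [C fC]] := bf.
have C0 : 0 <= C by rewrite (le_trans _ (proj1 (fC 0))).
have fa2 : f a / 2 < f a by rewrite ltr_pdivrMr// mulr2n mulrDr mulr1 ltrDl.
have : \forall x \near a, f a / 2 < f x.
  by have := cf a; move/cvgr_gt; apply.
move=> /nbhs_ballP[r /= r0 rf].
have [c [c0 c1 qc]] : exists c : R, [/\ 0 < c, c < 1 & forall x, `|x| <= C -> ~ ball a
  r x -> q x <= c].
  have [[y [yC yb]]|none] := pselect (exists y, `|y| <= C /\ ~ ball a r y); last first.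
    exists 2^-1; split; [by rewrite invr_gt0|by rewrite invf_lt1// ltr1n|].
    by move=> x xC xb; exfalso; apply: none; exists x.
  have cK : compact (box C `&` ~` ball a r).
    apply: (@subclosed_compact _ _ (box C)) (@compact_box _ C) _; last by move=> ? [].
    apply: closedI; last by apply: open_closedC; exact: ball_open.
    by apply: compact_closed (@compact_box _ C); exact: norm_hausdorff.
  have [||z] := @compact_EVT_max _ R q _ _ cK.
  - by exists y.
  - exact: continuous_subspaceT.
  rewrite inE => -[zC zb] zmax.
  have za : z != a by apply: contra_notN zb => /eqP ->; exact: ballxx.
  exists (Num.max (q z) 2^-1); split.
  - by rewrite lt_max invr_gt0 orbC ltr0n.
  - by rewrite gt_max q1//= invf_lt1// ltr1n.
  - by move=> x xC xb; rewrite le_max zmax// inE.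
pose b : R := (1 + c) / 2.
have cb : c < b by rewrite /b; lra.
have b1 : b < 1 by rewrite /b; lra.
have b0 : 0 < b by rewrite /b; lra.
have : \forall x \near a, b < q x /\ ball a r x.
  near=> x; split; last by near: x; exact: nbhsx_ballx.
  near: x; have := cq a; move/cvgr_gt; apply; first by rewrite qa.
move=> /nbhs_ballP[s /= s0 sq].
pose m := (s *+ 2) * (s *+ 2).
have m0 : 0 < m by rewrite mulr_gt0// pmulrn_rgt0.
have Em : fine (mu2 (ball a s)) = m by rewrite mu2_ball// ltW.
pose M := fine (mu2 (box C)).
have mB : measurable (ball a s : set plane) by apply: open_measurable_plane;
  exact: ball_open.
have mK : measurable (box C : set plane) by exact: measurable_box.
have key N : f a / 2 * m <= C * M * (c / b) ^+ N.
  pose lo x := (f a / 2 * b ^+ N) * \1_(ball a s) x + (- (C * c ^+ N)) * \1_(box C) x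
    : R.
  have bind A D : measurable (A : set plane) -> (forall x, A x -> `|x| <= D) ->
    bounded_bsupp (\1_A : R * R -> R).
    move=> mA AD; split; first exact: measurable_indic.
    exists (Num.max D 1) => x; rewrite indicE !le_max.
    case: (boolP (x \in A)) => [|_]; last by rewrite normr0 ler01 orbT eqxx.
    by rewrite inE => /AD ->; rewrite normr1 lexx orbT.
  have b1s : bounded_bsupp (\1_(ball a s) : R * R -> R).
    apply: (bind _ (`|a| + s)) => // x; rewrite -ball_normE/= => xs.
    rewrite -[x](subKr a) (le_trans (ler_normB _ _))// lerD2l.
    exact: ltW.
  have b2s : bounded_bsupp (\1_(box C) : R * R -> R) by apply: (bind _ C).
  have : \int[mu2]_x lo x <= \int[mu2]_x (f x * q x ^+ N).
    apply: le_Rintegral => //.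
    - apply: bounded_bsupp_integrable; apply: bounded_bsuppD; exact: bounded_bsuppZ.
    - apply: bounded_bsupp_integrable; apply: bounded_bsuppMc => // x.
      by apply: (@continuous_comp _ _ _ q (fun y => y ^+ N));
        [exact: cq|exact: exprn_continuous].
    move=> x _; rewrite /lo !indicE.
    have cN : 0 <= C * c ^+ N by rewrite mulr_ge0// exprn_ge0// ltW.
    have [xs|_] := boolP (x \in (ball a s : set (R * R))).
      have [bx ax] := sq x (set_mem xs).
      have fx := rf _ ax.
      have fx0 : f x != 0 by rewrite gt_eqF// (lt_trans _ fx)// divr_gt0.
      rewrite (@mem_set _ (box C)) /box/=; last by case: (fC x) => _; apply.
      rewrite !mulr1 (@le_trans _ _ (f a / 2 * b ^+ N))//;
        first by rewrite gerDl oppr_le0.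
      rewrite ler_pM//; [by rewrite divr_ge0// ltW|by rewrite exprn_ge0// ltW|exact:
        ltW|].
      by rewrite lerXn2r ?nnegrE ?ltW// (lt_trans b0).
    have [fx0|fx0] := eqVneq (f x) 0.
      by rewrite fx0 mul0r mulr0 add0r mulr_le0_ge0 ?oppr_le0.
    have xC : `|x| <= C by case: (fC x) => _; apply.
    rewrite (@mem_set _ (box C)) // mulr0 add0r mulr1.
    have qx0 : 0 <= q x ^+ N by rewrite exprn_ge0// q0.
    have [xr|xr] := pselect (ball a r x).
      rewrite (@le_trans _ _ 0)// ?oppr_le0// mulr_ge0// ltW//.
      by rewrite (lt_trans _ (rf _ xr))// divr_gt0.
    have fqC : `|f x * q x ^+ N| <= C * c ^+ N.
      rewrite normrM ler_pM//; first by case: (fC x).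
      rewrite ger0_norm//; apply: lerXn2r;
        [by rewrite nnegrE q0|by rewrite nnegrE ltW|exact: qc].
    by move: fqC; rewrite ler_norml => /andP[].
  rewrite fq0 Rintegral_bsuppD ?Rintegral_bsuppZ//; last 2 first.
  - exact: bounded_bsuppZ.
  - exact: bounded_bsuppZ.
  rewrite !/Rintegral !integral_indic// !setIT Em -/M => H.
  rewrite expr_div_n [leRHS]mulrA ler_pdivlMr ?exprn_gt0//.
  by move: H; rewrite -[X in _ <= X -> _]addr0; lra.
have : (fun N => C * M * (c / b) ^+ N) @ \oo --> C * M * 0.
  apply: cvgM; first exact: cvg_cst.
  apply: cvg_expr; rewrite ger0_norm ?ltr_pdivrMr ?mul1r//.
  by rewrite divr_ge0// ltW.
rewrite mulr0 => lim0.
have : f a / 2 * m <= 0.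
  rewrite -(cvg_lim _ lim0)//; apply: limr_ge; first by apply/cvg_ex; eexists;
    exact: lim0.
  exact: nearW.
by apply/negP; rewrite -ltNge mulr_gt0// divr_gt0.
Unshelve. all: end_near. Qed.
End peak.

(** * Exponential moments determine a function *)

Section laplace.
Context {R : realType}.
Local Notation mu2 := (@lebesgue_measure2 R).
Implicit Types (f g q : R * R -> R) (x a : R * R).

Lemma continuous_fst : continuous (fst : R * R -> R).
Proof. by move=> x; exact: cvg_fst. Qed.
Lemma continuous_snd : continuous (snd : R * R -> R).
Proof. by move=> x; exact: cvg_snd. Qed.
Lemma continuousD_fun f g : continuous f -> continuous g -> continuous (fun x => f x +
  g x).
Proof. by move=> cf cg x; apply: cvgD; [exact: cf|exact: cg]. Qed.
Lemma continuousM_fun f g : continuous f -> continuous g -> continuous (fun x => f x *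
  g x).
Proof. by move=> cf cg x; apply: cvgM; [exact: cf|exact: cg]. Qed.
Lemma continuousX_fun f n : continuous f -> continuous (fun x => f x ^+ n).
Proof. by move=> cf x; apply: (@continuous_comp _ _ _ f (fun y => y ^+ n));
  [exact: cf|exact: exprn_continuous]. Qed.
Lemma continuous_exp_fun f : continuous f -> continuous (fun x => expR (f x)).
Proof. by move=> cf x; apply: (@continuous_comp _ _ _ f expR);
  [exact: cf|exact: continuous_expR]. Qed.

(** In the coordinates y = exp x_1, z = exp x_2 the function
    q = 1 - ((y - y_a)^2 + (z - z_a)^2) / M is a polynomial which peaks exactly at a
      and,
    for M large, is nonnegative on the support of f.  The moments of f q^N are linear
    combinations of those of f. *)
Lemma exponential_moments_unique f : continuous f -> bounded_bsupp f ->
  (forall m n : nat, \int[mu2]_x (f x * (expR x.1 ^+ m * expR x.2 ^+ n)) = 0) ->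
  forall a, f a = 0.
Proof.
move=> cf bf f0 a.
pose y x := expR x.1 : R; pose z x := expR x.2 : R.
have cy : continuous y by apply: continuous_exp_fun; exact: continuous_fst.
have cz : continuous z by apply: continuous_exp_fun; exact: continuous_snd.
pose s x := (y x - y a) ^+ 2 + (z x - z a) ^+ 2.
have cs : continuous s.
  apply: continuousD_fun; apply: continuousX_fun; apply: continuousD_fun => //;
  by move=> ?; exact: cst_continuous.
have [C fC] := bf.2.
have [D sD] := continuous_bounded_on_box cs C.
have s0 x : 0 <= s x by rewrite addr_ge0// sqr_ge0.
have sa x : x != a -> 0 < s x.
  move=> xa; rewrite lt_neqAle s0 andbT eq_sym paddr_eq0 ?sqr_ge0// !sqrf_eq0 !subr_eq0.
  apply: contra xa => /andP[/eqP/expR_inj ya /eqP/expR_inj za].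
  by apply/eqP; rewrite [x]surjective_pairing [a]surjective_pairing ya za.
pose M := `|D| + 1.
have M0 : 0 < M by rewrite ltr_wpDl.
pose q x := 1 + - M^-1 * s x.
have cq : continuous q.
  apply: continuousD_fun; first by move=> ?; exact: cst_continuous.
  by apply: continuousM_fun => // ?; exact: cst_continuous.
have mom N : forall m n : nat, \int[mu2]_x (f x * (y x ^+ m * z x ^+ n * q x ^+ N)) = 0.
  elim: N => [|N IH] m n.
    by under eq_Rintegral do rewrite expr0 mulr1; exact: f0.
  pose h m n x := f x * (y x ^+ m * z x ^+ n * q x ^+ N).
  have bh m' n' : bounded_bsupp (h m' n').
    apply: bounded_bsuppMc => //; apply: continuousM_fun; last exact: continuousX_fun.
    by apply: continuousM_fun; exact: continuousX_fun.
  (* expansion of the extra factor q in powers of exp x_1 and exp x_2 *)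
  transitivity (\int[mu2]_x ((1 - M^-1 * (y a ^+ 2 + z a ^+ 2)) * h m n x + (
     (M^-1 * 2 * y a) * h m.+1 n x + ((- M^-1) * h m.+2 n x + (
     (M^-1 * 2 * z a) * h m n.+1 x + (- M^-1) * h m n.+2 x))))).
    by apply: eq_Rintegral => x _; rewrite /h /q /s !exprS; ring.
  have bb := fun r m n => bounded_bsuppZ r (bh m n).
  rewrite !Rintegral_bsuppD//;
    do ?[exact: bb|exact: bounded_bsuppD|apply: bounded_bsuppD].
  by rewrite !Rintegral_bsuppZ// !IH; ring.
have q1 x : x != a -> q x < 1.
  by move=> xa; rewrite gtrDl mulNr oppr_lt0 mulr_gt0 ?invr_gt0// sa.
have q0 x : f x != 0 -> 0 <= q x.
  move=> /(proj2 (fC x)) /sD; rewrite ger0_norm// => sxD.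
  rewrite /q mulNr subr_ge0 mulrC ler_pdivrMr// mul1r (le_trans sxD)//.
  by rewrite (le_trans (ler_norm _))// lerDl.
have qa : q a = 1 by rewrite /q /s !subrr expr0n/= addr0 mulr0 addr0.
have fq N : \int[mu2]_x (f x * q x ^+ N) = 0.
  by rewrite -(mom N 0 0); apply: eq_Rintegral => x _; rewrite !expr0 !mul1r.
apply/eqP; rewrite eq_le; apply/andP; split.
  by apply: (@Rintegral_peak _ f q).
have := @Rintegral_peak _ (fun x => -1 * f x) q a.
rewrite mulN1r oppr_le0; apply => //.
- by apply: continuousM_fun => // ?; exact: cst_continuous.
- exact: bounded_bsuppZ.
- by move=> x; rewrite mulN1r oppr_eq0; exact: q0.
- move=> N; transitivity (\int[mu2]_x (-1 * (f x * q x ^+ N))).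
    by apply: eq_Rintegral => x _; rewrite mulrA.
  by rewrite Rintegral_bsuppZ ?fq ?mulr0//; apply: bounded_bsuppMc => //;
    exact: continuousX_fun.
Qed.
End laplace.

(** * The flat function exp(-1/x) *)

Section flat.
Context {R : realType}.

(** These functions span the derivatives of all orders of exp(-1/x), so that
    smoothness can be proved by induction on the order. *)
Definition flat (n : nat) (x : R) : R :=
  if 0 < x then x^-1 ^+ n * expR (- x^-1) else 0.

Lemma flat_gt0 n x : 0 < x -> 0 < flat n x.
Proof. by move=> x0; rewrite /flat x0 mulr_gt0 ?expR_gt0 ?exprn_gt0 ?invr_gt0. Qed.

Lemma flat_eq0 n x : x <= 0 -> flat n x = 0.
Proof. by rewrite /flat ltNge => ->. Qed.

Lemma flat_ge0 n x : 0 <= flat n x.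
Proof. by case: (leP x 0) => [/flat_eq0->//|/(flat_gt0 n)/ltW]. Qed.

(** The square makes the difference quotient of [flat n] at 0 tend to 0. *)
Lemma flat_le n x : flat n x <= n.+2`!%:R * `|x| ^+ 2.
Proof.
case: (leP x 0) => [/flat_eq0->|x0]; first by rewrite mulr_ge0// exprn_ge0.
rewrite /flat x0 gtr0_norm// expRN ler_pdivrMr ?expR_gt0//.
have H : 1 + x^-1 ^+ n.+2 / n.+2`!%:R <= expR x^-1.
  by rewrite expR_ge1Dxn// invr_ge0 ltW.
have {}H : x^-1 ^+ n.+2 / n.+2`!%:R <= expR x^-1 by rewrite (le_trans _ H)// lerDr.
rewrite ler_pdivrMr ?ltr0n ?fact_gt0// in H.
have -> : x^-1 ^+ n = x ^+ 2 * x^-1 ^+ n.+2.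
  by rewrite -(addn2 n) exprD mulrCA -exprMn divff ?gt_eqF// expr1n mulr1.
have -> : n.+2`!%:R * x ^+ 2 * expR x^-1 = x ^+ 2 * (expR x^-1 * n.+2`!%:R) by ring.
by rewrite ler_pM2l// exprn_gt0.
Qed.

Lemma is_derive_flat (n : nat) (x : R) : is_derive x (1 : R) (flat n) (flat n.+2 x -
  n%:R * flat n.+1 x).
Proof.
have [x0|x0|->] := ltrgt0P x.
- have e : \near x, x^-1 ^+ n * expR (- x^-1) = flat n x.
    by near=> y; rewrite /flat ifT//; near: y; exact: lt_nbhsr.
  apply: near_eq_is_derive e _.
  have dV : is_derive x 1 (fun y : R => y^-1) (- x ^- 2).
    have dx : derivable (@id R) x 1 by exact: derivable_id.
    have x1 : id x != 0 :> R by rewrite gt_eqF.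
    split; first exact: (derivableV x1 dx).
    by rewrite (deriveV x1 dx) derive_id [_ *: _]mulr1.
  have dN : is_derive x 1 (fun y : R => - y^-1) (x ^- 2).
    by rewrite -[X in is_derive _ _ _ X]opprK; exact: is_deriveN.
  have dE := @is_derive1_comp _ expR _ _ _ _ (is_derive_expR _) dN.
  have dX := is_deriveX n dV.
  have -> : (fun y : R => y^-1 ^+ n * expR (- y^-1)) =
    (fun y : R => y^-1) ^+ n * (expR \o (fun y => - y^-1)).
    by apply/funext => y; rewrite /GRing.mul/= exprfctE.
  apply: (is_derive_eq (is_deriveM dX dE)).
  rewrite /flat x0 /GRing.scale/=.
  rewrite -exprVn /=; case: n {dX} => [|n];
    first by rewrite !mul0r mulr0 addr0 expr0 subr0 mul1r mulrC.
  rewrite exprfctE /= !exprS; move: (expR _) => E; ring.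
- have e : \near x, cst 0 x = flat n x.
    by near=> y; rewrite flat_eq0//= ltW//; near: y; exact: lt_nbhsl.
  by apply: near_eq_is_derive e _; rewrite !flat_eq0 ?ltW// mulr0 subrr;
    exact: is_derive_cst.
rewrite !flat_eq0// mulr0 subrr.
have H : (fun h => h^-1 *: ((flat n \o shift 0) (h *: 1) - flat n 0)) @ 0^' --> (0 : R).
  apply/cvgrPdist_le => e e0.
  have k0 : 0 < n.+2`!%:R :> R by rewrite ltr0n fact_gt0.
  near=> h.
  rewrite (flat_eq0 _ (lexx 0)) subr0 sub0r normrN /= addr0 [h *: 1]mulr1 normrZ normfV.
  rewrite ler_pdivrMl ?normr_gt0; last by near: h; exact: nbhs_dnbhs_neq.
  rewrite (ger0_norm (flat_ge0 _ _)) (le_trans (flat_le _ _))// expr2 mulrCA.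
  rewrite ler_wpM2l// -ler_pdivlMl// mulrC ltW//.
  near: h; apply: dnbhs0_lt; exact: divr_gt0.
split; first by apply/cvg_ex; exists 0.
by apply/cvg_lim.
Unshelve. all: end_near. Qed.
End flat.

(** * Calculus of smooth functions of two variables *)

Section smooth.
Context {R : realType}.
Implicit Types (f g : R * R -> R) (x a v : R * R).

Lemma differentiable_fst x : differentiable (fst : R * R -> R) x.
Proof.
by apply: (@linear_differentiable _ _ _ (fst : {linear (R * R)%type -> R}));
  exact: continuous_fst.
Qed.

Lemma differentiable_snd x : differentiable (snd : R * R -> R) x.
Proof.
by apply: (@linear_differentiable _ _ _ (snd : {linear (R * R)%type -> R}));
  exact: continuous_snd.
Qed.

Lemma derive_fst x v : 'D_v (fst : R * R -> R) x = v.1.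
Proof.
rewrite deriveE; last exact: differentiable_fst.
by rewrite (@diff_lin _ _ _ (fst : {linear (R * R)%type -> R}) x continuous_fst).
Qed.

Lemma derive_snd x v : 'D_v (snd : R * R -> R) x = v.2.
Proof.
rewrite deriveE; last exact: differentiable_snd.
by rewrite (@diff_lin _ _ _ (snd : {linear (R * R)%type -> R}) x continuous_snd).
Qed.

(** Differentiability and the chain rule are stated together because both are needed
    at each step of the inductions on the order of smoothness. *)
Lemma derive_comp1 (h : R -> R) f (d : R) x v : differentiable f x -> is_derive (f x)
  1 h d ->
  differentiable (fun y => h (f y)) x /\ 'D_v (fun y => h (f y)) x = d * 'D_v f x.
Proof.
move=> df [dh hd].
have dh' : differentiable h (f x) by apply/derivable1_diffP.
have dc : differentiable (h \o f) x by exact: differentiable_comp.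
split=> //; rewrite -[LHS]/('D_v (h \o f) x) (deriveE _ dc) diff_comp//=.
rewrite -(deriveE _ df) -[X in 'd h _ X]mulr1 -[X in 'd h _ X]/(_ *: _) linearZ/=.
by rewrite -(deriveE _ dh') hd mulrC.
Qed.
Lemma Ck_continuous k f : Ck k f -> continuous f.
Proof.
by case: k => [//|k] [df _ _] x; exact: differentiable_continuous.
Qed.

Lemma CkS k f : Ck k.+1 f -> Ck k f.
Proof.
elim: k f => [f /Ck_continuous//|k IH f [df d1 d2]].
by split; [exact: df|exact: (IH _ d1)|exact: (IH _ d2)].
Qed.

Lemma Ck_partials k f g1 g2 : (forall x, differentiable f x) ->
  (forall x, 'D_e1 f x = g1 x) -> (forall x, 'D_e2 f x = g2 x) ->
  Ck k g1 -> Ck k g2 -> Ck k.+1 f.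
Proof.
move=> df f1 f2 c1 c2; split=> //.
  by rewrite (_ : partial1 f = g1)//; apply/funext.
by rewrite (_ : partial2 f = g2)//; apply/funext.
Qed.

Lemma Ck_cst k (c : R) : Ck k (fun=> c).
Proof.
elim: k c => [c x|k IH c]; first exact: cst_continuous.
apply: (@Ck_partials _ _ (fun=> 0) (fun=> 0)) => [x|x|x| |].
- exact: (@differentiable_cst _ _ _ c x).
- exact: derive_cst.
- exact: derive_cst.
- exact: IH.
- exact: IH.
Qed.

Lemma Ck_fst k : Ck k (fst : R * R -> R).
Proof.
case: k => [|k]; first exact: continuous_fst.
apply: (@Ck_partials _ _ (fun=> e1.1) (fun=> e2.1));
  [exact: differentiable_fst| | |exact: Ck_cst|exact: Ck_cst];
  by move=> x; exact: derive_fst.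
Qed.

Lemma Ck_snd k : Ck k (snd : R * R -> R).
Proof.
case: k => [|k]; first exact: continuous_snd.
apply: (@Ck_partials _ _ (fun=> e1.2) (fun=> e2.2));
  [exact: differentiable_snd| | |exact: Ck_cst|exact: Ck_cst];
  by move=> x; exact: derive_snd.
Qed.

Lemma CkD k f g : Ck k f -> Ck k g -> Ck k (fun x => f x + g x).
Proof.
elim: k f g => [|k IH] f g; first exact: continuousD_fun.
move=> [df f1 f2] [dg g1 g2].
apply: (@Ck_partials _ _ _ _ _ _ _ (IH _ _ f1 g1) (IH _ _ f2 g2)) => x.
- by apply: differentiableD; [exact: df|exact: dg].
- by apply: deriveD; apply: diff_derivable; [exact: df|exact: dg].
- by apply: deriveD; apply: diff_derivable; [exact: df|exact: dg].
Qed.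

Lemma CkM k f g : Ck k f -> Ck k g -> Ck k (fun x => f x * g x).
Proof.
elim: k f g => [|k IH] f g; first exact: continuousM_fun.
move=> cf cg; have := (CkS cf, CkS cg) => -[cf' cg'].
move: cf cg => [df f1 f2] [dg g1 g2].
apply: (@Ck_partials _ _ (fun x => f x * partial1 g x + g x * partial1 f x)
  (fun x => f x * partial2 g x + g x * partial2 f x)) => [x|x|x| |].
- by apply: differentiableM; [exact: df|exact: dg].
- by apply: deriveM; apply: diff_derivable; [exact: df|exact: dg].
- by apply: deriveM; apply: diff_derivable; [exact: df|exact: dg].
- by apply: CkD; exact: IH.
- by apply: CkD; exact: IH.
Qed.

Lemma Ck_exp k f : Ck k f -> Ck k (fun x => expR (f x)).
Proof.
elim: k f => [|k IH] f; first exact: continuous_exp_fun.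
move=> cf; have cf' := IH _ (CkS cf).
move: cf => [df f1 f2].
have D v x := derive_comp1 v (df x) (is_derive_expR (f x)).
apply: (@Ck_partials _ _ (fun x => expR (f x) * partial1 f x) (fun x => expR (f x) *
  partial2 f x)) => [x|x|x| |].
- by case: (D 0 x).
- by case: (D e1 x).
- by case: (D e2 x).
- exact: CkM.
- exact: CkM.
Qed.

(** The statement for all n at once is what makes the induction work, the derivative
    of [flat n] being a combination of [flat n.+1] and [flat n.+2]. *)
Lemma Ck_flat k n f : Ck k f -> Ck k (fun x => flat n (f x)).
Proof.
elim: k n f => [|k IH] n f.
  move=> cf x; apply: (@continuous_comp _ _ _ f (flat n)); first exact: cf.
  apply/differentiable_continuous/derivable1_diffP.
  by case: (is_derive_flat n (f x)).
move=> cf; have cf' m := IH m _ (CkS cf).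
have cd : Ck k (fun x => flat n.+2 (f x) + - n%:R * flat n.+1 (f x)).
  by apply: CkD => //; apply: CkM => //; exact: Ck_cst.
move: cf => [df f1 f2].
have D v x := derive_comp1 v (df x) (is_derive_flat n (f x)).
apply: (@Ck_partials _ _ (fun x => (flat n.+2 (f x) + - n%:R * flat n.+1 (f x)) *
  partial1 f x)
  (fun x => (flat n.+2 (f x) + - n%:R * flat n.+1 (f x)) * partial2 f x)) => [x|x|x| |].
- by case: (D 0 x).
- by rewrite mulNr; case: (D e1 x).
- by rewrite mulNr; case: (D e2 x).
- exact: CkM.
- exact: CkM.
Qed.

Lemma Ck_inv k f : (forall x, f x != 0) -> Ck k f -> Ck k (fun x => (f x)^-1).
Proof.
move=> f0; elim: k => [cf x|k IH cf]; first by apply: cvgV => //; exact: cf.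
have ci := IH (CkS cf).
move: cf => [df f1 f2].
apply: (@Ck_partials _ _ (fun x => -1 * ((f x)^-1 * (f x)^-1) * partial1 f x)
  (fun x => -1 * ((f x)^-1 * (f x)^-1) * partial2 f x)) => [x|x|x| |].
- exact: differentiableV.
- by rewrite (deriveV (f0 x)); [rewrite mulN1r -invfM -expr2|apply: diff_derivable;
  exact: df].
- by rewrite (deriveV (f0 x)); [rewrite mulN1r -invfM -expr2|apply: diff_derivable;
  exact: df].
- by apply: CkM => //; apply: CkM; [exact: Ck_cst|exact: CkM].
- by apply: CkM => //; apply: CkM; [exact: Ck_cst|exact: CkM].
Qed.

Definition sqdist a x : R := (x.1 - a.1) ^+ 2 + (x.2 - a.2) ^+ 2.

Lemma Ck_sqdist k a : Ck k (sqdist a).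
Proof.
have h (i : R * R -> R) (c : R) : Ck k i -> Ck k (fun x => (i x - c) ^+ 2).
  by move=> ci; apply: CkM; apply: CkD => //; exact: Ck_cst.
by apply: CkD; apply: h; [exact: Ck_fst|exact: Ck_snd].
Qed.

(** The two constants 4 and 2 are such that the two terms of the denominator never
    vanish together; 2 rather than 1 because the disk of squared radius 2 r^2 contains
    the square [|x - a| < r] of the sup norm. *)
Definition bump a (r : R) x : R :=
  flat 0 (r ^+ 2 * 4 - sqdist a x) /
  (flat 0 (r ^+ 2 * 4 - sqdist a x) + flat 0 (sqdist a x - r ^+ 2 * 2)).

Lemma Ck_bump k a r : 0 < r -> Ck k (bump a r).
Proof.
move=> r0; have r20 : 0 < r ^+ 2 by rewrite exprn_gt0.
have c1 : Ck k (fun x => flat 0 (r ^+ 2 * 4 - sqdist a x)).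
  apply: Ck_flat; under eq_fun do rewrite -mulN1r.
  apply: CkD; [exact: Ck_cst|apply: CkM; [exact: Ck_cst|exact: Ck_sqdist]].
have c2 : Ck k (fun x => flat 0 (sqdist a x - r ^+ 2 * 2)).
  by apply: Ck_flat; apply: CkD; [exact: Ck_sqdist|exact: Ck_cst].
apply: CkM => //; apply: Ck_inv; last exact: CkD.
move=> x; rewrite gt_eqF//.
have [h|h] := ltP (sqdist a x) (r ^+ 2 * 4).
  by rewrite ltr_wpDr ?flat_ge0// flat_gt0// subr_gt0.
by rewrite ltr_wpDl ?flat_ge0// flat_gt0// subr_gt0 (lt_le_trans _ h)// ltr_pM2l//
  ltr_nat.
Qed.

Lemma bump1 a r x : 0 < r -> `|x - a| < r -> bump a r x = 1.
Proof.
move=> r0 xa; rewrite /bump.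
have r20 : 0 < r ^+ 2 by rewrite exprn_gt0.
have sr : sqdist a x < r ^+ 2 * 2.
  move: xa; rewrite prod_norm_lt /= => /andP[x1 x2].
  rewrite /sqdist -[X in X + _]real_normK ?num_real// -[X in _ + X]real_normK
    ?num_real//.
  by rewrite mulrDr mulr1 ltrD// ltrXn2r// ?nnegrE// ltW.
rewrite (@flat_eq0 _ 0 (sqdist a x - _)); last by rewrite subr_le0 ltW.
rewrite addr0 divff// gt_eqF// flat_gt0// subr_gt0 (lt_trans sr)//.
by rewrite ltr_pM2l// ltr_nat.
Qed.

Lemma bump0 a r x : 0 < r -> bump a r x != 0 -> `|x - a| <= r * 2.
Proof.
move=> r0; rewrite /bump; have [h|h] := ltP (sqdist a x) (r ^+ 2 * 4); last first.
  by rewrite flat_eq0 ?subr_le0// mul0r eqxx.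
move=> _; have r2 : 0 <= r * 2 by rewrite mulr_ge0// ltW.
have {}h : sqdist a x <= (r * 2) ^+ 2.
  by rewrite ltW// exprMn (_ : 2 ^+ 2 = 4)// -natrX.
rewrite prod_norm_le/=; apply/andP; split.
  rewrite -(@ler_pXn2r _ 2) ?nnegrE// real_normK ?num_real// (le_trans _ h)//.
  by rewrite lerDl sqr_ge0.
rewrite -(@ler_pXn2r _ 2) ?nnegrE// real_normK ?num_real// (le_trans _ h)//.
by rewrite lerDr sqr_ge0.
Qed.
End smooth.

(** * Smooth cutoff functions *)

Section cutoff.
Context {R : realType}.
Implicit Types (f g : R * R -> R) (x a v : R * R) (Omega K : set (R * R)).

Lemma compact_closed_bounded K (C : R) : closed K -> K `<=` box C -> compact K.
Proof.
by move=> cK KC; exact: (subclosed_compact cK (@compact_box R C)).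
Qed.

Lemma test_function_smaller Omega f g : test_function Omega f -> (forall k, Ck k g) ->
  (forall x, g x != 0 -> f x != 0) -> test_function Omega g.
Proof.
move=> [_ kf fO] cg gf.
have s : closure [set x | g x != 0] `<=` closure [set x | f x != 0].
  by apply: closure_subset => x; exact: gf.
split; [exact: cg| |exact: subset_trans fO].
by apply: (subclosed_compact _ kf s); exact: closed_closure.
Qed.

(** This is 1 - (1 - f)(1 - g): it is 1 where f or g is 1 and 0 where both are 0. *)
Lemma test_functionU Omega f g : test_function Omega f -> test_function Omega g ->
  test_function Omega (fun x => f x + g x * (1 + -1 * f x)).
Proof.
move=> [cf kf fO] [cg kg gO].
have s : closure [set x | f x + g x * (1 + -1 * f x) != 0] `<=`
    closure [set x | f x != 0] `|` closure [set x | g x != 0].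
  rewrite -closureU; apply: closure_subset => x /=.
  have [->|fx _] := eqVneq (f x) 0; last by left.
  by rewrite mulr0 addr0 mulr1 add0r => gx; right.
split.
- move=> k; apply: CkD; first exact: cf.
  apply: CkM; first exact: cg.
  by apply: CkD; [exact: Ck_cst|apply: CkM; [exact: Ck_cst|exact: cf]].
- by apply: (subclosed_compact _ _ s); [exact: closed_closure|exact: compactU].
- by move=> x /s[/fO|/gO].
Qed.

Lemma test_function_bump Omega a (r : R) : 0 < r -> [set x | `|x - a| <= r * 2] `<=`
  Omega ->
  test_function Omega (bump a r).
Proof.
move=> r0 aO; have s : closure [set x | bump a r x != 0] `<=` [set x | `|x - a| <= r *
  2].
  have cl : closed [set x | `|x - a| <= r * 2].
    apply: (@closed_comp _ _ (fun x => `|x - a|) [set t | t <= r * 2]);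
      last exact: closed_le.
    move=> x _; apply: (@continuous_comp _ _ _ (fun x => x - a) (fun x => `|x|));
      last exact: norm_continuous.
    by apply: cvgB; [exact: cvg_id|exact: cvg_cst].
  rewrite [X in _ `<=` X]((closure_id _).1 cl).
  by apply: closure_subset => x /=; exact: bump0.
split; first by move=> k; exact: Ck_bump.
  apply: (@compact_closed_bounded _ (`|a| + r * 2)); first exact: closed_closure.
  by move=> x /s /= xa;
    rewrite /box/= -[x](subrK a) (le_trans (ler_normD _ _))// addrC lerD2l.
exact: subset_trans aO.
Qed.

(** Otherwise the sets B such that P holds for K minus B form a proper filter
    containing K, without cluster point in K. *)
Lemma compact_induction (T : topologicalType) (P : set T -> Prop) (K : set T) :
  P set0 -> (forall A B, P A -> P B -> P (A `|` B)) ->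
  (forall A B, A `<=` B -> P B -> P A) ->
  (forall z : T, K z -> exists2 U, nbhs z U & P U) -> compact K -> P K.
Proof.
move=> P0 PU PS Ploc cK; apply: contrapT => nPK.
(* the filter of the complements of the sets satisfying P, relatively to K *)
pose F : set_system T := [set B | P (K `\` B)].
have FF : ProperFilter F.
  split; first by rewrite /F/= setD0.
  split; first by rewrite /F/= setDT.
    by move=> A B FA FB; rewrite /F/= setDIr; exact: PU.
  by move=> A B AB FA; apply: PS FA => x [Kx Bx]; split => // /AB.
have FK : F K by rewrite /F/= setDv.
have [x [Kx xF]] := cK F FF FK.
have [U xU PU'] := Ploc x Kx.
have FU : F (~` U) by apply: (PS _ U) => // y [_] /contrapT.
by have [y []] := xF _ _ FU xU.
Qed.

Lemma cutoff_function Omega K : open Omega -> compact K -> K `<=` Omega ->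
  exists2 chi, test_function Omega chi & forall x, K x -> \forall y \near x, chi y = 1.
Proof.
move=> oO cK KO.
pose P (A : set (R * R)) := exists2 chi, test_function Omega chi & forall x, A x ->
  \forall y \near x, chi y = 1.
apply: (@compact_induction _ P) => //.
- exists (fun=> 0) => //.
  have s0 : [set x : R * R | (0 : R) != 0] = set0.
    by apply/seteqP; split => // x /=; rewrite eqxx.
  split; first by move=> k; exact: Ck_cst.
    by rewrite s0 closure0; exact: compact0.
  by rewrite s0 closure0.
- move=> A B [f tf f1] [g tg g1].
  exists (fun x => f x + g x * (1 + -1 * f x)); first exact: test_functionU.
  move=> x [/f1|/g1]; apply: filterS => y ->; ring.
- by move=> A B AB [f tf f1]; exists f => // x /AB /f1.
move=> x Kx.
have /nbhs_ballP[e /= e0 eO] : nbhs x Omega.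
  by apply: open_nbhs_nbhs; split => //; exact: KO.
have r0 : 0 < e / 4 by rewrite divr_gt0.
exists (ball x (e / 4)); first exact: nbhsx_ballx.
exists (bump x (e / 4)).
  apply: test_function_bump => // y /= yx.
  apply: eO; rewrite -ball_normE/= distrC (le_lt_trans yx)//; lra.
move=> y yx; have : nbhs y (ball x (e / 4)).
  by apply: open_nbhs_nbhs; split => //; exact: ball_open.
by apply: filterS => z; rewrite -ball_normE/= distrC => /bump1 ->.
Qed.
End cutoff.

(** * Normals of a strictly convex domain *)

Section boundary.
Context {R : realType}.
Implicit Types (f g : R -> R) (x a v eta zeta theta : R * R) (Omega K : set (R * R)).

Lemma pair_ext (u w : R * R) : u.1 = w.1 -> u.2 = w.2 -> u = w.
Proof. by case: u w => [? ?] [? ?] /= -> ->. Qed.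

(** The frame in which the boundary charts are written. *)
Lemma dot_basis (e d : R * R) : unit_circle e ->
  d = dot d (- rot90 e) *: - rot90 e + dot d e *: e.
Proof.
rewrite /unit_circle /dot /= => e1E.
apply: pair_ext => /=.
- transitivity ((e.1 * e.1 + e.2 * e.2) * d.1); first by rewrite e1E mul1r.
  by rewrite /GRing.scale/=; ring.
- transitivity ((e.1 * e.1 + e.2 * e.2) * d.2); first by rewrite e1E mul1r.
  by rewrite /GRing.scale/=; ring.
Qed.

Lemma convex_toward_boundary Omega zeta x (t : R) : strictly_convex Omega ->
  open Omega -> boundary Omega zeta -> Omega x -> 0 < t -> t <= 1 ->
  Omega (zeta + t *: (x - zeta)).
Proof.
move=> sc oO [czeta]; rewrite ((interior_id _).1 oO) => nzeta Ox t0 t1.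
move: t1; rewrite le_eqVlt => /predU1P[->|t1]; first by rewrite scale1r addrC subrK.
have -> : zeta + t *: (x - zeta) = t *: x + (1 - t) *: zeta.
  by rewrite scalerBr scalerBl scale1r addrCA addrA.
by apply: sc => //; [exact: subset_closure|move=> xz; apply: nzeta; rewrite -xz].
Qed.

(** All directions close to x - zeta point into the domain for a full unit of length,
    by convexity.  If the normal eta had a nonnegative product with x - zeta, then
      tilting
    x - zeta slightly towards eta would give such a direction d with eta . d > 0, which
    leaves the domain to first order because the boundary is the graph of g. *)
Lemma inner_direction alpha Omega zeta x : strictly_convex Omega -> open Omega ->
  C2_boundary alpha Omega -> boundary Omega zeta -> Omega x ->
  exists2 eta, outer_unit_normal Omega zeta eta & dot eta (x - zeta) < 0.
Proof.
move=> sc oO C2 bz Ox.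
have [e [r [h [g [ch [dg _ _]]]]]] := C2 _ bz.
have [ue r0 h0 g0 chg] := ch.
have dg0 : derivable g 0 1 by apply: dg; rewrite in_itv/= oppr_lt0 r0.
pose N := e - derive1 g 0 *: - rot90 e.
pose c := (Num.sqrt (1 + derive1 g 0 ^+ 2))^-1.
have c0 : 0 < c by rewrite invr_gt0 sqrtr_gt0 ltr_wpDr// sqr_ge0.
exists (c *: N); first by exists e, r, h, g.
have dotZ (k : R) u w : dot (k *: u) w = k * dot u w.
  by rewrite /dot /= /GRing.scale/=; ring.
rewrite dotZ pmulr_rlt0// ltNge; apply/negP => Nx.
have dotN : dot N N = 1 + derive1 g 0 ^+ 2.
  move: ue; rewrite /unit_circle /N /dot/= => ue.
  transitivity ((1 + derive1 g 0 ^+ 2) * (e.1 * e.1 + e.2 * e.2));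
    last by rewrite ue mulr1.
  by rewrite /GRing.scale/=; ring.
have N0 : 0 < dot N N by rewrite dotN ltr_wpDr// sqr_ge0.
have [s s0 Os] : exists2 s : R, 0 < s & Omega (x + s *: N).
  have cs : (fun s : R => x + s *: N) @ (0 : R) --> x.
    rewrite -[X in _ --> X]addr0 -(scale0r N); apply: cvgD; first exact: cvg_cst.
    by apply: cvgZl; exact: cvg_id.
  have : \forall s \near (0 : R)^'+, Omega (x + s *: N).
    apply: cvg_within; apply: cs; exact: open_nbhs_nbhs.
  move=> nO; near (0 : R)^'+ => s; exists s; last by near: s.
  by near: s; exact: nbhs_right_gt.
pose d := x + s *: N - zeta.
have Nd : 0 < dot N d.
  have -> : dot N d = dot N (x - zeta) + s * dot N N by rewrite /dot/= /GRing.scale/=;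
    ring.
  by rewrite ltr_wpDl// mulr_gt0.
pose a := dot d (- rot90 e); pose b := dot d e.
have NdE : dot N d = b - derive1 g 0 * a by rewrite /N /b /a /dot/= /GRing.scale/=;
  ring.
have dd : is_derive (0 : R) (1 : R) (fun t : R => g (t * a)) (derive1 g 0 * a).
  have dl : is_derive (0 : R) (1 : R) (fun t : R => t * a) a.
    have := is_deriveM (@is_derive_id _ _ (0 : R) (1 : R)) (@is_derive_cst _ _ _ a (0
      : R) (1 : R)).
    by rewrite scaler0 add0r [_ *: _]mulr1.
  apply: (@is_derive1_comp _ g _ _ _ _ _ dl).
  by rewrite mul0r derive1E; exact: derivableP.
have gl : (fun t : R => t^-1 * g (t * a)) @ 0^'+ --> derive1 g 0 * a.
  have [dd1 dd2] := dd; apply: cvg_dnbhs_at_right; rewrite -dd2.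
  apply: cvg_trans dd1; apply: near_eq_cvg; apply: nearW => t /=.
  by rewrite mul0r g0 subr0 addr0 [t *: 1]mulr1.
have small (k l : R) : 0 < l -> \forall t \near (0 : R)^'+, t * k \in `]- l, l[.
  move=> l0.
  have : (fun t : R => t * k) @ (0 : R)^'+ --> 0 * k.
    by apply: cvgMr_tmp; apply: cvg_within_filter; exact: cvg_id.
  rewrite mul0r => /cvgrPdist_lt /(_ _ l0); apply: filterS => t.
  by rewrite sub0r normrN in_itv/= ltr_norml.
(* a point zeta + t d of the domain lies under the graph: b < g (t a) / t *)
near (0 : R)^'+ => t.
have t0 : 0 < t by near: t; exact: nbhs_right_gt.
have Ot : Omega (zeta + t *: d).
  apply: convex_toward_boundary => //; near: t; exact: nbhs_right_le.
have : t * b < g (t * a).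
  have tar : t * a \in `]- r, r[ by near: t; exact: small.
  have tbh : t * b \in `]- h, h[ by near: t; exact: small.
  apply/(chg _ _ tar tbh); rewrite -!scalerA -addrA -scalerDr.
  by rewrite -dot_basis.
rewrite mulrC -ltr_pdivlMr// mulrC ltNge => /negP; apply; apply: ltW.
near: t; have /cvgr_lt := gl; apply.
by move: Nd; rewrite NdE subr_gt0.
Unshelve. all: end_near. Qed.

End boundary.

(** * The transport equation along lines *)

Section transport.
Context {R : realType}.
Implicit Types (x a v eta zeta theta : R * R) (Omega K : set (R * R)).

Lemma dotZr (k : R) u w : dot u (k *: w : R * R) = k * dot u w.
Proof. by rewrite /dot /= /GRing.scale/=; ring. Qed.

Lemma dotZl (k : R) u w : dot (k *: u : R * R) w = k * dot u w.
Proof. by rewrite /dot /= /GRing.scale/=; ring. Qed.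

Lemma continuous_exp_dot (xi : R * R) : continuous (fun y : R * R => expR (dot xi y)).
Proof.
apply: continuous_exp_fun; apply: continuousD_fun; apply: continuousM_fun.
- by move=> ?; exact: cst_continuous.
- exact: continuous_fst.
- by move=> ?; exact: cst_continuous.
- exact: continuous_snd.
Qed.

(** With [boundary_plus_ray], this shows that the difference of two solutions with the
    same data vanishes at both ends of every chord. *)
Lemma boundary_minus_ray alpha Omega zeta theta (t : R) : strictly_convex Omega ->
  open Omega ->
  C2_boundary alpha Omega -> boundary Omega zeta -> unit_circle theta -> 0 < t ->
  Omega (zeta + t *: theta) -> boundary_minus Omega (zeta, theta).
Proof.
move=> sc oO C2 bz ut t0 Ot; split => //=.
have [eta neta] := inner_direction sc oO C2 bz Ot.
rewrite addrC addKr dotZr pmulr_rlt0// => etat; by exists eta.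
Qed.

Lemma boundary_plus_ray alpha Omega zeta theta (t : R) : strictly_convex Omega -> open
  Omega ->
  C2_boundary alpha Omega -> boundary Omega zeta -> unit_circle theta -> t < 0 ->
  Omega (zeta + t *: theta) -> boundary_plus Omega (zeta, theta).
Proof.
move=> sc oO C2 bz ut t0 Ot; split => //=.
have [eta neta] := inner_direction sc oO C2 bz Ot.
rewrite addrC addKr dotZr nmulr_rlt0// => etat; by exists eta.
Qed.

Lemma vector_basisE (theta : R * R) : theta = theta.1 *: e1 + theta.2 *: e2.
Proof. by apply: pair_ext => /=;
  rewrite /GRing.scale/= !(mulr1, mulr0, addr0, add0r). Qed.

Lemma derive_grad (f : R * R -> R) x theta : differentiable f x ->
  'D_theta f x = dot theta (grad f x).
Proof.
move=> df; rewrite deriveE// {1}(vector_basisE theta) linearD !linearZ/=.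
by rewrite -!deriveE.
Qed.

Lemma derive_exp_dot (xi x theta : R * R) :
  is_derive x theta (fun y => expR (dot xi y)) (dot theta xi * expR (dot xi x)).
Proof.
have ck : Ck 1 (fun y : R * R => dot xi y).
  by apply: CkD; apply: CkM; [exact: Ck_cst|exact: Ck_fst|exact: Ck_cst|exact: Ck_snd].
have [dE _ _] := Ck_exp ck.
have [dd _ _] := ck.
have [_ D] := derive_comp1 theta (dd x) (is_derive_expR (dot xi x)).
split; first exact: diff_derivable.
rewrite D mulrC; congr (_ * _).
rewrite deriveD; last 2 first.
- apply: diff_derivable; apply: differentiableM; first exact: differentiable_cst.
  exact: differentiable_fst.
- apply: diff_derivable; apply: differentiableM; first exact: differentiable_cst.
  exact: differentiable_snd.
rewrite !deriveM; try (apply: diff_derivable); try exact: differentiable_cst;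
  try exact: differentiable_fst; try exact: differentiable_snd.
rewrite !derive_cst derive_fst derive_snd !scaler0 !addr0 /dot.
by rewrite /GRing.scale/=; ring.
Qed.

Lemma is_derive_line_near0 (v : R * R -> R) x theta :
  (\forall t \near (0 : R), v (x + t *: theta) = 0) -> is_derive x theta v 0.
Proof.
move=> v0; have vx : v x = 0 by have := nbhs_singleton v0; rewrite scale0r addr0.
have H : (fun h => h^-1 *: ((v \o shift x) (h *: theta) - v x)) @ 0^' --> (0 : R).
  have c0 : (fun h : R => 0 : R) @ 0^' --> (0 : R) by exact: cvg_cst.
  apply: cvg_trans c0; apply: near_eq_cvg; near=> h.
  rewrite /= vx subr0 addrC.
  have -> : v (x + h *: theta) = 0 by near: h; exact: nbhs_dnbhs v0.
  by rewrite scaler0.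
split; first by apply/cvg_ex; exists 0.
by apply/cvg_lim.
Unshelve. all: end_near. Qed.

(** The factor exp(xi . x) absorbs the attenuation, since theta . xi = mu. *)
Lemma is_derive_exp_mul (w : R * R -> R) (xi theta x : R * R) (mu f : R) :
  dot theta xi = mu -> differentiable w x -> dot theta (grad w x) + mu * w x = f ->
  is_derive x theta (fun y => w y * expR (dot xi y)) (f * expR (dot xi x)).
Proof.
move=> tx dw eqw.
have dwt : is_derive x theta w (dot theta (grad w x)).
  by split; [exact: diff_derivable|exact: derive_grad].
have := is_deriveM dwt (derive_exp_dot xi x theta).
by rewrite tx -eqw; congr is_derive; rewrite /GRing.scale/=; ring.
Qed.

(** Near zeta the source vanishes, so w exp(xi . x) is constant along the chord which
    starts at zeta, and its value at zeta is 0. *)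
Lemma transport_near_boundary Omega K (theta xi zeta : R * R) (mu : R) (f w : R * R ->
  R) :
  strictly_convex Omega -> open Omega -> closed K -> ~ K zeta ->
  unit_circle theta -> dot theta xi = mu -> (forall x, ~ K x -> f x = 0) ->
  {within closure Omega, continuous w} ->
  (forall x, Omega x -> differentiable w x /\ dot theta (grad w x) + mu * w x = f x) ->
  boundary Omega zeta ->
  (forall t, Omega (zeta + t *: theta) -> w zeta = 0) ->
  \forall t \near (0 : R), Omega (zeta + t *: theta) -> w (zeta + t *: theta) = 0.
Proof.
move=> sc oO cK nK ut tx fK cw eqw bz wz.
have oK : open (~` K) by exact: closed_openC.
have /nbhs_ballP[eps /= eps0 epsK] : nbhs zeta (~` K) by exact: open_nbhs_nbhs.
have ray s t : `|s| <= 1 -> `|t| < eps -> ~ K (zeta + (s * t) *: theta).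
  move=> s1 te; apply: epsK; rewrite -ball_normE/= opprD addNKr normrN normrZ.
  have th1 : `|theta| <= 1.
    move: ut; rewrite /unit_circle /dot/= => ut.
    rewrite prod_norm_le; apply/andP; split.
      rewrite -(@ler_pXn2r _ 2) ?nnegrE// real_normK ?num_real// expr1n -ut expr2.
      by rewrite lerDl -expr2 sqr_ge0.
    rewrite -(@ler_pXn2r _ 2) ?nnegrE// real_normK ?num_real// expr1n -ut expr2.
    by rewrite lerDr -expr2 sqr_ge0.
  rewrite (le_lt_trans _ te)// normrM.
  rewrite -[leRHS]mul1r -[leRHS]mulr1 ler_pM ?mulr_ge0// ler_pM//.
near=> t => Ot.
have te : `|t| < eps.
  by near: t; exists eps => // y; rewrite /= sub0r normrN.
have l s : 0 < s -> s <= 1 -> Omega (zeta + s *: (t *: theta)).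
  move=> s0 s1; have -> : t *: theta = (zeta + t *: theta) - zeta by rewrite addrC
    addKr.
  exact: convex_toward_boundary.
(* w exp(xi . x) along the chord; the mean value theorem shows psi 1 = psi 0 *)
pose psi (s : R) := w (zeta + s *: (t *: theta)) * expR (dot xi (zeta + s *: (t *:
  theta))).
have [||c _] := @MVT _ psi (fun=> 0) 0 1 ltr01.
- move=> s; rewrite in_itv/= => /andP[s0 s1].
  apply: (@is_derive_along _ (fun y => w y * expR (dot xi y)) (t *: theta)).
  have Os := l _ s0 (ltW s1).
  have [dw ew] := eqw _ Os.
  have fs : f (zeta + s *: (t *: theta)) = 0.
    by apply: fK; rewrite scalerA; apply: ray => //; rewrite ger0_norm ltW.
  rewrite -[X in is_derive _ _ _ X](mul0r (expR (dot xi (zeta + s *: (t *: theta))))).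
  apply: (is_derive_exp_mul (mu := t * mu)) => //; first by rewrite dotZl tx.
  by rewrite dotZl -mulrA -mulrDr ew fs mulr0.
- apply/subspace_continuousP => s; rewrite /= in_itv/= => /andP[s0 s1].
  have cl : continuous (fun s : R => zeta + s *: (t *: theta)).
    by move=> z; apply: cvgD; [exact: cvg_cst|apply: cvgZl; exact: cvg_id].
  have Os : closure Omega (zeta + s *: (t *: theta)).
    move: s0; rewrite le_eqVlt => /predU1P[<-|s0]; last by apply: subset_closure;
      exact: l.
    by rewrite scale0r addr0; case: bz.
  apply: cvgM; last first.
    apply: cvg_within_filter.
    apply: (@continuous_comp _ _ _ (fun s : R => zeta + s *: (t *: theta)) (fun y =>
      expR (dot xi y))).
      exact: cl.
    exact: continuous_exp_dot.
  move/subspace_continuousP : cw => /(_ _ Os) cw.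
  apply: cvg_comp cw => A; rewrite /within/= => HA.
  have H : \forall z \near s, closure Omega (zeta + z *: (t *: theta)) ->
      A (zeta + z *: (t *: theta)) := cl s _ HA.
  change (\forall z \near s, `[0, 1]%classic z -> A (zeta + z *: (t *: theta))).
  apply: filterS H => z zA; rewrite /= in_itv/= => /andP[z0 z1].
  apply: zA; move: z0; rewrite le_eqVlt => /predU1P[<-|z0];
    last by apply: subset_closure; exact: l.
  by rewrite scale0r addr0; case: bz.
rewrite mul0r /psi scale0r scale1r addr0 (wz _ Ot) mul0r subr0 => /eqP.
by rewrite mulf_eq0 expR_eq0 orbF => /eqP.
Unshelve. all: end_near. Qed.
(** Inside the domain this is the transport equation.  At a boundary point the zero
    extension vanishes on a whole segment of direction theta around the point.  At the
    other points it vanishes in a neighbourhood. *)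
Lemma is_derive_zero_extension alpha Omega K (theta xi : R * R) (mu : R) (f w : R * R
  -> R) :
  strictly_convex Omega -> open Omega -> C2_boundary alpha Omega ->
  closed K -> K `<=` Omega ->
  unit_circle theta -> dot theta xi = mu -> (forall x, ~ K x -> f x = 0) ->
  {within closure Omega, continuous w} ->
  (forall x, Omega x -> differentiable w x /\ dot theta (grad w x) + mu * w x = f x) ->
  (forall zeta, boundary_minus Omega (zeta, theta) -> w zeta = 0) ->
  (forall zeta, boundary_plus Omega (zeta, theta) -> w zeta = 0) ->
  forall x, is_derive x theta (fun y => (w \_ Omega) y * expR (dot xi y)) (f x * expR
    (dot xi x)).
Proof.
move=> sc oO C2 cK KO ut tx fK cw eqw wm wp x.
have [Ox|nOx] := pselect (Omega x).
  have [dw ew] := eqw _ Ox.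
  apply: near_eq_is_derive (is_derive_exp_mul tx dw ew).
  have : \near x, Omega x by exact: open_nbhs_nbhs.
  by apply: filterS => y Oy; rewrite patchE mem_set.
have nKx : ~ K x by move=> /KO.
rewrite fK// mul0r; apply: is_derive_line_near0.
have cl : (fun t : R => x + t *: theta) @ (0 : R) --> x.
  rewrite -[X in _ --> X]addr0 -(scale0r theta); apply: cvgD; first exact: cvg_cst.
  by apply: cvgZl; exact: cvg_id.
have [cx|ncx] := pselect (closure Omega x); last first.
  have ncO : nbhs x (~` closure Omega).
    by apply: open_nbhs_nbhs; split => //; apply: closed_openC; exact: closed_closure.
  have ncl : nbhs (0 : R) _ := cl _ ncO.
  apply: filterS ncl => t nct; rewrite patchE memNset ?mul0r// => Ot.
  by apply: nct; exact: subset_closure.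
have bx : boundary Omega x by split => //; rewrite ((interior_id _).1 oO).
have wx t : Omega (x + t *: theta) -> w x = 0.
  have [t0|t0|->] := ltrgtP t 0.
  - by move=> Ot; apply: wp; exact: (boundary_plus_ray sc oO C2 bx ut _ Ot).
  - by move=> Ot; apply: wm; exact: (boundary_minus_ray sc oO C2 bx ut _ Ot).
  - by rewrite scale0r addr0.
have := transport_near_boundary sc oO cK nKx ut tx fK cw eqw bx wx.
apply: filterS => t wt; rewrite patchE; case: ifPn; last by rewrite mul0r.
by rewrite in_setE => /wt ->; rewrite mul0r.
Qed.

Lemma compact_closure_bounded Omega : bounded_set Omega -> compact (closure Omega).
Proof.
move=> [M [_ OM]]; apply: (@compact_closed_bounded _ _ (M + 1));
  first exact: closed_closure.
have -> : box (M + 1) = closure (box (M + 1)).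
  by apply/closure_id; apply: compact_closed (@compact_box _ _); exact: norm_hausdorff.
by apply: closure_subset => x Ox; apply: (OM (M + 1)); rewrite ?ltrDl.
Qed.

Lemma open_continuous_measurable_plane Omega (f : R * R -> R) : open Omega ->
  {in Omega, continuous f} ->
  measurable_fun (Omega : set (measurableTypeR R * measurableTypeR R)) f.
Proof.
move=> oO cf; have cf' : continuous (f : subspace Omega -> R).
  by rewrite (continuous_open_subspace f oO).
move/continuousP : cf' => cf'.
apply: (measurability _ (RGenOpens.measurableE R)).
move=> _ [_ [a [b ->] <-]].
have /open_subspaceP[V oV VD] := cf' _ (@interval_open R (BRight a) (BLeft b) isT isT).
rewrite setIC -VD; apply: measurableI.
  exact: open_measurable_plane.
exact: open_measurable_plane.
Qed.

(** The zero extension jumps at the boundary points where w does not vanish, hence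
    the two hypotheses, for its boundedness and for its measurability. *)
Lemma bounded_bsupp_zero_extension Omega (w : R * R -> R) : bounded_set Omega -> open
  Omega ->
  {within closure Omega, continuous w} -> {in Omega, continuous w} -> bounded_bsupp (w
    \_ Omega).
Proof.
move=> bO oO cw cwO; split.
  apply/(measurable_restrictT _ (open_measurable_plane oO)).
  exact: open_continuous_measurable_plane.
have /compact_bounded[M [_ Mw]] := continuous_compact cw (compact_closure_bounded bO).
move: bO => [C [_ CO]].
exists (Num.max (C + 1) (`|M| + 1)) => x; rewrite patchE !le_max.
case: (boolP (x \in Omega)) => [|_]; last first.
  by rewrite normr0 eqxx; split => //; apply/orP; right; rewrite addr_ge0.
rewrite inE => Ox; split => [|_].
  apply/orP; right; apply: (Mw (`|M| + 1)); last by exists x => //;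
    exact: subset_closure.
  by rewrite (le_lt_trans (ler_norm M))// ltrDl.
by apply/orP; left; apply: (CO (C + 1)); rewrite ?ltrDl.
Qed.

Lemma exponential_ray_orthogonality alpha Omega K (theta xi : R * R) (mu : R) (f w : R
  * R -> R) :
  strictly_convex Omega -> open Omega -> bounded_set Omega -> C2_boundary alpha Omega ->
  closed K -> K `<=` Omega ->
  unit_circle theta -> dot theta xi = mu -> (forall x, ~ K x -> f x = 0) ->
  continuous f ->
  {within closure Omega, continuous w} ->
  (forall x, Omega x -> differentiable w x /\ dot theta (grad w x) + mu * w x = f x) ->
  (forall zeta, boundary_minus Omega (zeta, theta) -> w zeta = 0) ->
  (forall zeta, boundary_plus Omega (zeta, theta) -> w zeta = 0) ->
  \int[@lebesgue_measure2 R]_x (f x * expR (dot xi x)) = 0.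
Proof.
move=> sc oO bO C2 cK KO ut tx fK cf cw eqw wm wp.
have cE := continuous_exp_dot (xi := xi).
apply: (Rintegral_directional_derivative _ _ (is_derive_zero_extension sc oO C2 cK KO
  ut tx fK cw eqw wm wp)).
  apply: bounded_bsuppMc => //; apply: bounded_bsupp_zero_extension => //.
  move=> x; rewrite inE => Ox; apply: differentiable_continuous.
  by case: (eqw x Ox).
apply: bounded_bsuppMc => //.
have -> : f = f \_ Omega.
  apply/funext => x; rewrite patchE; case: ifPn => //; rewrite notin_setE => nO.
  by apply: fK => /KO.
apply: bounded_bsupp_zero_extension => //.
exact: continuous_subspaceT.
Qed.
End transport.

(** * Tensor fields and their moments *)

Section fields.
Context {R : realType}.
Local Notation plane := (measurableTypeR R * measurableTypeR R)%type.
Local Notation mu2 := (@lebesgue_measure2 R).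
Implicit Types (x xi theta : R * R) (Omega K : set (R * R)) (F G : R * R -> 'M[R]_2).

Lemma ae_imply (P Q : R * R -> Prop) : {ae mu2, forall x, P x} ->
  (forall x, P x -> Q x) -> {ae mu2, forall x, Q x}.
Proof. by move=> aP PQ; apply: negligibleS aP => x; exact: contra_not (PQ x). Qed.

Lemma ae_imply2 (P Q S : R * R -> Prop) : {ae mu2, forall x, P x} ->
  {ae mu2, forall x, Q x} -> (forall x, P x -> Q x -> S x) -> {ae mu2, forall x, S x}.
Proof.
move=> aP aQ PQS; apply: negligibleS (negligibleU aP aQ) => x nS.
by apply: contrapT => /not_orP[/contrapT Px /contrapT Qx]; exact: nS (PQS x Px Qx).
Qed.

(** Negation exchanges the positive and negative parts; when both have an infinite
    integral, both members are 0. *)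
Lemma RintegralN (D : set plane) (f : R * R -> R) :
  \int[mu2]_(x in D) (- f x) = - \int[mu2]_(x in D) f x.
Proof.
rewrite /Rintegral integralE [in RHS]integralE.
have -> : (fun x => (- f x)%:E) = (fun x => - (f x)%:E)%E by [].
rewrite (funeposN (fun x => (f x)%:E)) (funenegN (fun x => (f x)%:E)).
have := @integral_ge0 _ _ R mu2 D ((fun x => (f x)%:E)^\+)%E (fun x _ => funepos_ge0 _
  x).
have := @integral_ge0 _ _ R mu2 D ((fun x => (f x)%:E)^\-)%E (fun x _ => funeneg_ge0 _
  x).
move: (integral _ _ _) => a; move: (integral _ _ _) => b.
case: a b => [a||] [b||] //= _ _; rewrite ?oppr0//.
by rewrite opprB.
Qed.

Lemma eq_Rintegral_ae (D : set plane) (f g : R * R -> R) : measurable D ->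
  measurable_fun D f -> measurable_fun D g ->
  {ae mu2, forall x, D x -> f x = g x} ->
  \int[mu2]_(x in D) f x = \int[mu2]_(x in D) g x.
Proof.
move=> mD mf mg fg; rewrite /Rintegral; congr fine.
apply: ae_eq_integral => //; [exact/measurable_EFinP|exact/measurable_EFinP|].
by apply: (ae_imply fg) => x fgx Dx; rewrite fgx.
Qed.

Lemma closed_ess_support F : closed (ess_support F).
Proof.
rewrite -[X in closed X]setCK; apply: open_closedC.
rewrite openE => x /existsNP[U /not_implyP[[oU Ux] /contrapT F0]].
apply: (@filterS _ _ _ U) => [y Uy|]; last exact: open_nbhs_nbhs.
by move=> /(_ U (conj oU Uy)).
Qed.

Lemma representative_outside_support Omega F G : open Omega ->
  {in Omega, continuous G} -> ae_eq_on Omega F G ->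
  forall x, Omega x -> ~ ess_support (patch (fun=> 0) Omega F) x -> G x = 0.
Proof.
move=> oO cG FG x Ox /existsNP[U /not_implyP[[oU Ux] /contrapT F0]].
apply: (@ae_eq_continuous R (Omega `&` U) 'M[R]_2 G (fun=> 0)) => //.
- exact: openI.
- by move=> y; rewrite inE => -[Oy _]; apply: cG; rewrite inE.
- by move=> y _; exact: cst_continuous.
- apply: (ae_imply2 FG F0) => y FGy F0y [Oy Uy].
  by rewrite -FGy//; have := F0y Uy; rewrite /patch mem_set.
Qed.

Lemma continuous_zero_extension Omega K (f : R * R -> R) : open Omega -> closed K ->
  K `<=` Omega -> {in Omega, continuous f} -> (forall x, Omega x -> ~ K x -> f x = 0) ->
  continuous (f \_ Omega).
Proof.
move=> oO cK KO cf f0 x.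
have [Ox|nOx] := pselect (Omega x).
  have fx : f @ x --> (f \_ Omega) x by rewrite patchE mem_set//; apply: cf;
    rewrite inE.
  apply: cvg_trans fx; apply: near_eq_cvg.
  have : nbhs x Omega by exact: open_nbhs_nbhs.
  by apply: filterS => y Oy; rewrite patchE mem_set.
have nKx : (~` K) x by move=> /KO.
have vx : (f \_ Omega) x = 0 by rewrite patchE memNset.
have c0 : (fun=> 0 : R) @ x --> (f \_ Omega) x by rewrite vx; exact: cvg_cst.
apply: cvg_trans c0; apply: near_eq_cvg.
have : nbhs x (~` K) by apply: open_nbhs_nbhs; split => //; exact: closed_openC.
apply: filterS => y nKy; rewrite patchE; case: ifPn => //; rewrite inE => Oy.
by rewrite f0.
Qed.

Lemma bounded_bsupp_compact K (f : R * R -> R) : compact K -> continuous f ->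
  (forall x, ~ K x -> f x = 0) -> bounded_bsupp f.
Proof.
move=> cK cf f0; split; first exact: continuous_measurable_plane.
have [C [_ KC]] := compact_bounded cK.
have [D fD] := continuous_bounded_on_box cf (C + 1).
have xC x : f x != 0 -> `|x| <= C + 1.
  move=> fx; apply: (KC (C + 1)); first by rewrite ltrDl.
  by apply: contrapT => /f0 /eqP; apply/negP.
exists (Num.max (C + 1) `|D|) => x; rewrite !le_max; split; last by move=> /xC ->.
apply/orP; right; have [->|/xC/fD fxD] := eqVneq (f x) 0; first by rewrite normr0.
by rewrite (le_trans fxD)// ler_norm.
Qed.

Lemma continuous_entry (U : set (R * R)) G i j : {in U, continuous G} ->
  {in U, continuous (fun x => G x i j)}.
Proof.
move=> cG x xU; apply: (@continuous_comp _ _ _ G (fun A : 'M[R]_2 => A i j)).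
  exact: cG.
exact: coord_continuous.
Qed.

Lemma incompressible_test Omega F G phi : open Omega -> incompressible Omega F ->
  {in Omega, continuous G} -> ae_eq_on Omega F G -> test_function Omega phi ->
  forall i, \int[mu2]_(x in Omega) (G x i 0 * partial1 phi x) +
    \int[mu2]_(x in Omega) (G x i 1 * partial2 phi x) = 0.
Proof.
move=> oO incF cG FG tphi i.
have [g1 [g2 [[lF0 lg1 wg1] [lF1 lg2 wg2] g12]]] := incF i.
have mO : measurable (Omega : set plane) by exact: open_measurable_plane.
have [ck _ _] := tphi.
have mc (f : R * R -> R) : continuous f -> measurable_fun (Omega : set plane) f.
  by move=> cf; apply: measurable_funTS; exact: continuous_measurable_plane.
have mG j : measurable_fun (Omega : set plane) (fun x => G x i j).
  by apply: open_continuous_measurable_plane => //; exact: continuous_entry.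
have [_ c1 c2] := ck 1%N.
have E (j : 'I_2) (dphi : R * R -> R) : continuous dphi -> loc_integrable Omega (fun x
  => F x i j) ->
    \int[mu2]_(x in Omega) (G x i j * dphi x) = \int[mu2]_(x in Omega) (F x i j * dphi
      x).
  move=> cd [mF _]; apply: eq_Rintegral_ae => //.
  - by apply: measurable_funM => //; exact: mc.
  - by apply: measurable_funM => //; exact: mc.
  - by apply: (ae_imply FG) => x FGx Ox; rewrite FGx.
rewrite !E//.
have := wg1 _ tphi => /= ->; have := wg2 _ tphi => /= ->.
rewrite !expr1 !mulN1r.
have -> : \int[mu2]_(x in Omega) (g2 x * phi x) = \int[mu2]_(x in Omega) (- (g1 x *
  phi x)).
  apply: eq_Rintegral_ae => //.
  - by apply: measurable_funM; [case: lg2|apply: mc; exact: (ck 0%N)].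
  - apply: measurable_funN.
    by apply: measurable_funM; [case: lg1|apply: mc; exact: (ck 0%N)].
  - apply: (ae_imply g12) => x gx Ox; have := gx Ox => /eqP.
    by rewrite addrC addr_eq0 => /eqP ->; rewrite mulNr.
by rewrite RintegralN opprK addNr.
Qed.

Lemma derive_near_eq (f g : R * R -> R) x v : (\forall y \near x, f y = g y) ->
  differentiable g x -> 'D_v f x = 'D_v g x.
Proof.
move=> fg dg; have gd : is_derive x v g ('D_v g x).
  by apply: derivableP; exact: diff_derivable.
have /near_eq_is_derive H : \near x, g x = f x by apply: filterS fg => y ->.
by have [_] := H _ _ gd.
Qed.

(** The test function is exp(xi . x) times a cutoff equal to 1 near K; its gradient on
    K is exp(xi . x) xi. *)
Lemma divergence_free_moments Omega K F G xi : open Omega -> compact K -> K `<=` Omega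
  ->
  incompressible Omega F ->
  {in Omega, continuous G} -> ae_eq_on Omega F G ->
  (forall x, Omega x -> ~ K x -> G x = 0) ->
  forall i, xi.1 * \int[mu2]_x (((fun y => G y i 0) \_ Omega) x * expR (dot xi x)) +
    xi.2 * \int[mu2]_x (((fun y => G y i 1) \_ Omega) x * expR (dot xi x)) = 0.
Proof.
move=> oO cK KO incF cG FG G0 i.
have [chi tchi chi1] := cutoff_function oO cK KO.
pose E y := expR (dot xi y).
have ckE k : Ck k E.
  by apply: Ck_exp; apply: CkD; apply: CkM;
    [exact: Ck_cst|exact: Ck_fst|exact: Ck_cst|exact: Ck_snd].
have tphi : test_function Omega (fun x => chi x * E x).
  apply: (test_function_smaller tchi).
    by move=> k; apply: CkM; [case: tchi|exact: ckE].
  by move=> x; rewrite mulf_eq0 negb_or => /andP[].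
rewrite -(incompressible_test oO incF cG FG tphi i).
have bb j : bounded_bsupp ((fun y => G y i j) \_ Omega).
  apply: (bounded_bsupp_compact cK).
    apply: continuous_zero_extension oO _ KO (continuous_entry cG) _.
      by apply: compact_closed cK; exact: norm_hausdorff.
    by move=> x Ox nKx; rewrite G0// mxE.
  move=> x nKx; rewrite patchE; case: ifPn => //; rewrite inE => Ox.
  by rewrite G0// mxE.
have part v x : K x -> 'D_v (fun x => chi x * E x) x = dot v xi * E x.
  move=> Kx; have [_ <-] := derive_exp_dot xi x v.
  apply: derive_near_eq; last by case: (ckE 1%N) => + _ _; apply.
  by apply: filterS (chi1 _ Kx) => y ->; rewrite mul1r.
have Emul j v (c : R) : dot v xi = c ->
    c * \int[mu2]_x (((fun y => G y i j) \_ Omega) x * expR (dot xi x)) =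
    \int[mu2]_(x in Omega) (G x i j * 'D_v (fun x => chi x * E x) x).
  move=> vc; rewrite -Rintegral_bsuppZ; last first.
    by apply: bounded_bsuppMc => //; exact: Ck_continuous (ckE 0%N).
  rewrite [RHS]Rintegral_mkcond; apply: eq_Rintegral => x _.
  rewrite !patchE; case: ifPn; last by rewrite mul0r mulr0.
  rewrite inE => Ox; have [Kx|nKx] := pselect (K x); last first.
    by rewrite G0// mxE !mul0r mulr0.
  by rewrite part// vc -/(E x); ring.
congr (_ + _); apply: Emul; rewrite /dot/=.
  by rewrite mul1r mul0r addr0.
by rewrite mul0r mul1r add0r.
Qed.

(** A symmetric matrix which kills xi is a multiple of the square of the vector
    orthogonal to xi, so its quadratic form vanishes at theta, not parallel to xi, only
    if the matrix is zero.  With D the determinant of xi and theta, D^2 times each entry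
    is an explicit combination of the three equations. *)
Lemma symmetric_form_eq0 (l00 l01 l11 x1 x2 t1 t2 : R) :
  x1 * l00 + x2 * l01 = 0 -> x1 * l01 + x2 * l11 = 0 ->
  l00 * t1 ^+ 2 + 2 * l01 * t1 * t2 + l11 * t2 ^+ 2 = 0 ->
  x1 * t2 - x2 * t1 != 0 -> [/\ l00 = 0, l01 = 0 & l11 = 0].
Proof.
set q := _ + _ + _; set D := _ - _ => E0 E1 Eq D0.
have D20 : D ^+ 2 != 0 by rewrite expf_eq0.
split; apply: (mulfI D20); rewrite mulr0.
- transitivity (x2 ^+ 2 * q + t2 ^+ 2 * (x1 * (x1 * l00 + x2 * l01) - x2 * (x1 * l01 +
  x2 * l11)) -
    2 * x2 * t1 * t2 * (x1 * l00 + x2 * l01)); first by rewrite /D /q; ring.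
  by rewrite Eq E0 E1; ring.
- transitivity (- x1 * x2 * q + x1 * t2 ^+ 2 * (x1 * l01 + x2 * l11) +
    x2 * t1 ^+ 2 * (x1 * l00 + x2 * l01)); first by rewrite /D /q; ring.
  by rewrite Eq E0 E1; ring.
- transitivity (x1 ^+ 2 * q + t1 ^+ 2 * (x2 * (x1 * l01 + x2 * l11) - x1 * (x1 * l00 +
  x2 * l01)) -
    2 * x1 * t1 * t2 * (x1 * l01 + x2 * l11)); first by rewrite /D /q; ring.
  by rewrite Eq E0 E1; ring.
Qed.

(** theta is the combination of xi and of its rotation for which the component along
    xi is mu / |xi|; the other component is positive since |xi| > mu. *)
Lemma unit_vector_with_component xi (mu : R) : mu ^+ 2 < dot xi xi ->
  exists theta, [/\ unit_circle theta, dot theta xi = mu & xi.1 * theta.2 - xi.2 *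
    theta.1 != 0].
Proof.
set rho := dot xi xi => mur.
have rho0 : rho != 0 by rewrite gt_eqF// (le_lt_trans _ mur)// sqr_ge0.
pose s := Num.sqrt (rho - mu ^+ 2).
have s2 : s ^+ 2 = rho - mu ^+ 2 by rewrite sqr_sqrtr// subr_ge0 ltW.
(* s is the component of theta along the rotated vector, times |xi| *)
exists (rho^-1 *: (mu *: xi + s *: rot90 xi)); rewrite /unit_circle.
split.
- transitivity (rho^-1 ^+ 2 * ((mu ^+ 2 + s ^+ 2) * rho)).
    by rewrite /rho /dot/= /GRing.scale/=; ring.
  by rewrite s2 addrC subrK expr2; field.
- transitivity (rho^-1 * (mu * rho)); first by rewrite /rho /dot/= /GRing.scale/=; ring.
  by field.
- suff -> : xi.1 * (rho^-1 *: (mu *: xi + s *: rot90 xi)).2 -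
    xi.2 * (rho^-1 *: (mu *: xi + s *: rot90 xi)).1 = s.
    by rewrite gt_eqF// sqrtr_gt0 subr_gt0.
  transitivity (rho^-1 * (s * rho)); first by rewrite /rho /dot/= /GRing.scale/=; ring.
  by field.
Qed.
End fields.

(** * Uniqueness *)

Section uniqueness.
Context {R : realType}.
Local Notation plane := (measurableTypeR R * measurableTypeR R)%type.
Local Notation mu2 := (@lebesgue_measure2 R).
Implicit Types (x xi theta : R * R) (Omega K : set (R * R)) (F G : R * R -> 'M[R]_2).

(** The frequencies (mu + 1 + m, n) have norm greater than mu. *)
Lemma laplace_unique (mu : R) (f : R * R -> R) : 0 < mu -> continuous f ->
  bounded_bsupp f ->
  (forall xi, mu ^+ 2 < dot xi xi -> \int[mu2]_x (f x * expR (dot xi x)) = 0) ->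
  forall x, f x = 0.
Proof.
move=> mu0 cf bf f0 x.
pose c : R * R := (mu + 1, 0).
have cE := @continuous_exp_dot R c.
apply/eqP; rewrite -[_ == _]orbF -(expR_eq0 (dot c x)) -mulf_eq0; apply/eqP; move: x.
apply: exponential_moments_unique.
- exact: continuousM_fun.
- exact: bounded_bsuppMc.
- move=> m n; rewrite -(f0 (mu + 1 + m%:R, n%:R)).
    apply: eq_Rintegral => x _; rewrite -mulrA -!expRM_natl -!expRD.
    by congr (_ * expR _); rewrite /dot/=; ring.
  rewrite /dot/= -!expr2 ltr_wpDr ?sqr_ge0// ltrXn2r// ?nnegrE ?addr_ge0// ?ltW//.
  by rewrite -addrA ltrDl ltr_wpDr.
Qed.

(** By linearity the moments of the difference satisfy both the identity coming from
    incompressibility and, since the data agree, the one coming from the transport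
    equation; they vanish at all frequencies of norm greater than mu. *)
Lemma incompressible_field_unique Omega (alpha mu p : R)
    (oO : open Omega) (bO : bounded_set Omega) (sc : strictly_convex Omega)
    (C2 : C2_boundary alpha Omega) (mu0 : 0 < mu)
    F F' (hF : admissible_field Omega p F) (hF' : admissible_field Omega p F')
    (u u' : R * R -> R * R -> R)
    (hu : bvp_solution Omega mu F u) (hu' : bvp_solution Omega mu F' u')
    (hdata : forall zeta theta, boundary_plus Omega (zeta, theta) ->
      u zeta theta = u' zeta theta) : ae_eq_on Omega F F'.
Proof.
move: hu hu' => [G [cG FG cu equ um]] [G' [cG' FG' cu' equ' um']].
move: hF hF' => [symF _ suppF incF] [symF' _ suppF' incF'].
pose S := ess_support (patch (fun=> 0) Omega F).
pose S' := ess_support (patch (fun=> 0) Omega F').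
(* a compact subset of the domain outside which both representatives vanish *)
pose K := S `|` S'.
have KO : K `<=` Omega by move=> x [/suppF|/suppF'].
have clK : closed K by apply: closedU; exact: closed_ess_support.
have cK : compact K.
  apply: (subclosed_compact clK (compact_closure_bounded bO)).
  by apply: subset_trans KO _; exact: subset_closure.
have G0 x : Omega x -> ~ K x -> G x = 0.
  move=> Ox nKx; apply: (representative_outside_support oO cG FG Ox) => Sx.
  by apply: nKx; left.
have G'0 x : Omega x -> ~ K x -> G' x = 0.
  move=> Ox nKx; apply: (representative_outside_support oO cG' FG' Ox) => Sx.
  by apply: nKx; right.
pose d (G : R * R -> 'M[R]_2) i j := (fun x => G x i j) \_ Omega.
have dK (H : R * R -> 'M[R]_2) : (forall x, Omega x -> ~ K x -> H x = 0) ->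
    forall i j x, ~ K x -> d H i j x = 0.
  move=> H0 i j x nKx; rewrite /d patchE; case: ifPn => //; rewrite inE => Ox.
  by rewrite H0// mxE.
have cd (H : R * R -> 'M[R]_2) : {in Omega, continuous H} ->
    (forall x, Omega x -> ~ K x -> H x = 0) -> forall i j, continuous (d H i j).
  move=> cH H0 i j; apply: continuous_zero_extension oO clK KO (continuous_entry cH) _.
  by move=> x Ox nKx; rewrite H0// mxE.
have sd (H H' : R * R -> 'M[R]_2) : {in Omega, continuous H'} -> symmetric_field Omega
  H ->
    ae_eq_on Omega H H' -> forall x, d H' 0 1 x = d H' 1 0 x.
  move=> cH sH HH x; rewrite /d !patchE; case: ifPn => //; rewrite inE.
  move: x; apply: (@ae_eq_continuous R Omega R (fun x => H' x 0 1) (fun x => H' x 1 0)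
    oO).
  - exact: continuous_entry.
  - exact: continuous_entry.
  - apply: (ae_imply2 sH HH) => x + + Ox => /(_ Ox) sx /(_ Ox) hx.
    by rewrite -hx -[in LHS]sx mxE.
have cdG := cd _ cG G0; have cdG' := cd _ cG' G'0.
pose D i j x := d G i j x + -1 * d G' i j x.
have cD i j : continuous (D i j).
  apply: continuousD_fun => //; apply: continuousM_fun => //.
  by move=> ?; exact: cst_continuous.
have DK i j x : ~ K x -> D i j x = 0.
  by move=> nKx; rewrite /D !dK// mulr0 addr0.
have bG i j : bounded_bsupp (d G i j).
  by apply: (bounded_bsupp_compact cK) => //; exact: dK.
have bG' i j : bounded_bsupp (d G' i j).
  by apply: (bounded_bsupp_compact cK) => //; exact: dK.
have bD i j : bounded_bsupp (D i j) by apply: (bounded_bsupp_compact cK) => //;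
  exact: DK.
have symD x : D 0 1 x = D 1 0 x by rewrite /D (sd _ _ cG symF FG) (sd _ _ cG' symF'
  FG').
(* the Laplace transform of the difference *)
pose L i j xi := \int[mu2]_x (D i j x * expR (dot xi x)).
have symL xi : L 1 0 xi = L 0 1 xi.
  by apply: eq_Rintegral => x _; rewrite symD.
have bE f xi : bounded_bsupp f -> bounded_bsupp (fun x => f x * expR (dot xi x)).
  by move=> bf; apply: bounded_bsuppMc => //; exact: continuous_exp_dot.
have divL xi i : xi.1 * L i 0 xi + xi.2 * L i 1 xi = 0.
  have LE j : L i j xi = \int[mu2]_x (d G i j x * expR (dot xi x)) +
      -1 * \int[mu2]_x (d G' i j x * expR (dot xi x)).
    transitivity (\int[mu2]_x (d G i j x * expR (dot xi x) +
        -1 * (d G' i j x * expR (dot xi x)))).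
      by apply: eq_Rintegral => x _; rewrite /D mulrDl !mulrA.
    by rewrite Rintegral_bsuppD ?Rintegral_bsuppZ//;
      [exact: bE|exact: bE|apply: bounded_bsuppZ; exact: bE].
  have := divergence_free_moments xi oO cK KO incF cG FG G0 i.
  have := divergence_free_moments xi oO cK KO incF' cG' FG' G'0 i.
  rewrite !LE /d => h1 h2; rewrite -[RHS](subrr 0) -{1}h2 -h1; ring.
have rayL xi theta : unit_circle theta -> dot theta xi = mu ->
    L 0 0 xi * theta.1 ^+ 2 + 2 * L 0 1 xi * theta.1 * theta.2 + L 1 1 xi * theta.2 ^+
      2 = 0.
  move=> ut tx.
  pose f x := theta.1 ^+ 2 * D 0 0 x + (2 * theta.1 * theta.2 * D 0 1 x + theta.2 ^+ 2
    * D 1 1 x).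
  have -> : L 0 0 xi * theta.1 ^+ 2 + 2 * L 0 1 xi * theta.1 * theta.2 + L 1 1 xi *
    theta.2 ^+ 2 =
      \int[mu2]_x (f x * expR (dot xi x)).
    transitivity (\int[mu2]_x (theta.1 ^+ 2 * (D 0 0 x * expR (dot xi x)) +
      (2 * theta.1 * theta.2 * (D 0 1 x * expR (dot xi x)) +
       theta.2 ^+ 2 * (D 1 1 x * expR (dot xi x))))).
      have bZ c i j := bounded_bsuppZ c (bE _ xi (bD i j)).
      rewrite Rintegral_bsuppD ?Rintegral_bsuppD ?Rintegral_bsuppZ//; try exact: bE;
        try exact: bZ.
        by rewrite /L; ring.
      exact: bounded_bsuppD.
    by apply: eq_Rintegral => x _; rewrite /f; ring.
  apply: (exponential_ray_orthogonality (w := fun x => u x theta - u' x theta)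
    sc oO bO C2 clK KO ut tx).
  - by move=> x nKx; rewrite /f !DK// !mulr0 !addr0.
  - by apply: continuousD_fun; [|apply: continuousD_fun]; apply: continuousM_fun => //;
      move=> ?; exact: cst_continuous.
  - move=> x; apply: cvgB; [exact: cu|exact: cu'].
  - move=> x Ox; have [du eu] := equ x theta Ox ut;
    have [du' eu'] := equ' x theta Ox ut.
    split; first exact: differentiableB.
    have -> : grad (fun x => u x theta - u' x theta) x =
        grad (u^~ theta) x - grad (u'^~ theta) x.
      rewrite /grad /partial1 /partial2; apply: pair_ext => /=;
      by apply: deriveB; exact: diff_derivable.
    transitivity ((dot theta (grad (u^~ theta) x) + mu * u x theta) -
      (dot theta (grad (u'^~ theta) x) + mu * u' x theta)).
      by rewrite /dot/=; ring.
    rewrite eu eu' /f symD /D /d !patchE !mem_set//.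
    have [s s'] := (sd _ _ cG symF FG x, sd _ _ cG' symF' FG' x).
    move: s s'; rewrite /d !patchE !mem_set// => s s'.
    by rewrite /dot /tapply/= s s'; ring.
  - by move=> zeta bz; rewrite um ?um' ?subrr.
  - by move=> zeta bz; rewrite hdata ?subrr.
have D0 i j x : D i j x = 0.
  apply: (laplace_unique mu0 (cD i j) (bD i j)) => xi mxi.
  have [theta [ut tx nz]] := unit_vector_with_component mxi.
  have := divL xi 0; have := divL xi 1; rewrite symL => d1 d0.
  have [l00 l01 l11] := symmetric_form_eq0 d0 d1 (rayL xi theta ut tx) nz.
  have I2 (k : 'I_2) : k = 0 \/ k = 1.
    by case: k => [[|[|//]] k]; [left|right]; exact: val_inj.
  case: (I2 i) (I2 j) => -> [] ->; [exact: l00|exact: l01| |exact: l11].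
  by rewrite -[LHS]/(L 1 0 xi) symL.
apply: (ae_imply2 FG FG') => x FGx FGx' Ox; rewrite FGx// FGx'//.
apply/matrixP => i j; have := D0 i j x; rewrite /D /d !patchE !mem_set// mulN1r.
by move/eqP; rewrite subr_eq0 => /eqP.
Qed.
End uniqueness.

Unset Implicit Arguments.
Set Strict Implicit.

Theorem theorem3p1 (R : realType) (Omega : set (R * R)) (alpha mu p : R)
    (hdom : domain Omega) (hbounded : bounded_set Omega)
    (hconvex : strictly_convex Omega)
    (halpha : 1 / 2 < alpha) (hboundary : C2_boundary alpha Omega)
    (hmu : 0 < mu) (hp : 4 < p)
    (F F' : R * R -> 'M[R]_2)
    (hF : admissible_field Omega p F) (hF' : admissible_field Omega p F')
    (u u' : R * R -> R * R -> R)
    (hu : bvp_solution Omega mu F u)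
    (hu' : bvp_solution Omega mu F' u')
    (hdata : forall zeta theta, boundary_plus Omega (zeta, theta) ->
      u zeta theta = u' zeta theta) :
  ae_eq_on Omega F F'.
Proof.
have [oO _ _] := hdom.
exact: (incompressible_field_unique oO hbounded hconvex hboundary hmu hF hF' hu hu' hdata).
Qed.
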